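(* Let $G$ be a compact Lie group with Lie algebra $\mathfrak{g}$, equipped with an $\mathrm{Ad}$-invariant inner product, let $T\subset G$ be a maximal torus with Lie algebra $\tau$, and let $\mathfrak{g}=\tau\oplus\mathfrak{l}_1\oplus\cdots\oplus\mathfrak{l}_m$ be the orthogonal decomposition of $\mathfrak{g}$ into $\tau$ and the root spaces $\mathfrak{l}_1,\dots,\mathfrak{l}_m$. Then for all distinct indices $i,j\in\{1,\dots,m\}$, $$[\mathfrak{l}_i,\mathfrak{l}_j]\subset \mathfrak{l}_{ij}^+\oplus\mathfrak{l}_{ij}^-.$$
   Context: $\langle\cdot,\cdot\rangle$ is a fixed inner product on $\mathfrak{g}$ that is $\mathrm{Ad}$-invariant: $\langle \mathrm{Ad}_gX,\mathrm{Ad}_gY\rangle=\langle X,Y\rangle$ for all $g\in G$, $X,Y\in\mathfrak{g}$. The decomposition $\mathfrak{g}=\tau\oplus\mathfrak{l}_1\oplus\cdots\oplus\mathfrak{l}_m$ is orthogonal, and each root space $\mathfrak{l}_i$ is a 2-dimensional subspace with $\mathrm{Ad}_g(\mathfrak{l}_i)\subset\mathfrak{l}_i$ for all $g\in T$; such a decomposition exists and is unique up to order. For each $i$ fix an ordered orthonormal basis $\{E_i,F_i\}$ of $\mathfrak{l}_i$ and set $\hat\alpha_i:=[E_i,F_i]$, which lies in $\tau$. The dual roots of $G$ are the vectors $\pm\hat\alpha_1,\dots,\pm\hat\alpha_m$, and the root space of the dual root $\pm\hat\alpha_k$ is $\mathfrak{l}_k$ (no two of $\hat\alpha_1,\dots,\hat\alpha_m$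 are parallel, so this is well defined). If $\hat\alpha_i+\hat\alpha_j$ equals a dual root, $\mathfrak{l}_{ij}^+$ denotes its root space; otherwise $\mathfrak{l}_{ij}^+:=\{0\}$. If $\hat\alpha_i-\hat\alpha_j$ equals a dual root, $\mathfrak{l}_{ij}^-$ denotes its root space; otherwise $\mathfrak{l}_{ij}^-:=\{0\}$. *)

(* Defs.v *)
From HB Require Import structures.
From mathcomp Require Import all_boot all_order all_algebra.
From mathcomp Require Import all_classical all_reals all_analysis.

Set Implicit Arguments.
Unset Strict Implicit.
Unset Printing Implicit Defensive.
Import Order.TTheory GRing.Theory Num.Theory.
Import numFieldNormedType.Exports.
Local Open Scope classical_set_scope.
Local Open Scope ring_scope.

(* In finite dimension, and for U open, Ck k U f says that f is k times
   differentiable on U with continuous k-th derivatives. *)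
Fixpoint Ck (R : realType) (V W : normedModType R) (k : nat)
    (U : set V) (f : V -> W) : Prop :=
  if k is j.+1 then
    (forall x, U x -> differentiable f x) /\ (forall v, Ck j U ('D_v f))
  else forall x, U x -> {for x, continuous f}.

Definition smooth_on (R : realType) (V W : normedModType R)
    (U : set V) (f : V -> W) : Prop := forall k, Ck k U f.

(* The values of cfun outside cdom and of cinv outside cimg are irrelevant. *)
Record chart (R : realType) (n : nat) (G : Type) := Chart {
  cdom : set G;
  cfun : G -> 'rV[R]_n;
  cinv : 'rV[R]_n -> G }.

Definition cimg (R : realType) (n : nat) (G : Type) (c : chart R n G) :
  set 'rV[R]_n := cfun c @` cdom c.

Definition is_chart (R : realType) (n : nat) (G : topologicalType)
    (c : chart R n G) : Prop :=
  [/\ open (cdom c), open (cimg c),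
      (forall x, cdom c x -> cinv c (cfun c x) = x),
      (forall x, cdom c x -> {for x, continuous (cfun c)}) &
      (forall u, cimg c u -> {for u, continuous (cinv c)})].

HB.mixin Record isTopologicalGroup G of Topological G & Group G := {
  mulg_continuous : continuous (fun p : G * G => (p.1 * p.2)%g);
  invg_continuous : continuous (fun x : G => x^-1%g) }.

#[short(type="topGroupType")]
HB.structure Definition TopologicalGroup :=
  {G of isTopologicalGroup G & Topological G & Group G}.

(* Lie groups of dimension n. Second countability is not required: it is
   automatic for a compact group. *)
HB.mixin Record isLieGroup (R : realType) (n : nat) G
    of TopologicalGroup G := {
  atlas : set (chart R n G);
  lie_hausdorff : hausdorff_space G;
  atlas_chart : forall c, atlas c -> is_chart c;
  atlas_cover : forall x : G, exists2 c, atlas c & cdom c x;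
  atlas_smooth : forall a b, atlas a -> atlas b ->
    smooth_on (cfun a @` (cdom a `&` cdom b)) (cfun b \o cinv a);
  mulg_smooth : forall a b c, atlas a -> atlas b -> atlas c ->
    smooth_on
      [set p : 'rV[R]_n * 'rV[R]_n |
        [/\ cimg a p.1, cimg b p.2 & cdom c (cinv a p.1 * cinv b p.2)%g]]
      (fun p => cfun c (cinv a p.1 * cinv b p.2)%g);
  invg_smooth : forall a b, atlas a -> atlas b ->
    smooth_on [set u | cimg a u /\ cdom b (cinv a u)^-1%g]
      (fun u => cfun b (cinv a u)^-1%g) }.

#[short(type="lieGroupType")]
HB.structure Definition LieGroup (R : realType) (n : nat) :=
  {G of isLieGroup R n G & TopologicalGroup G}.

(* A chart c around the identity identifies the Lie algebra, i.e. the tangent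
   space at the identity, with 'rV[R]_n. *)
Definition chart_at1 (R : realType) (n : nat) (G : lieGroupType R n)
    (c : chart R n G) : Prop := atlas c /\ cdom c 1%g.

Section LieAlgebra.
Context {R : realType} {n : nat} {G : lieGroupType R n}.
Variable c : chart R n G.

(* The differential at the identity of the conjugation x |-> g x g^-1. *)
Definition Ad (g : G) : 'rV[R]_n -> 'rV[R]_n :=
  'd (fun u => cfun c (g * cinv c u * g^-1)%g) (cfun c 1%g).

(* [X, Y] = ad_X Y, where ad is the differential at the identity of Ad; this
   agrees with the bracket of left-invariant vector fields. *)
Definition lie_bracket (X Y : 'rV[R]_n) : 'rV[R]_n :=
  'd (fun u => Ad (cinv c u) Y) (cfun c 1%g) X.

(* The tangent space at the identity of a closed subgroup H: the initial
   velocities of the curves in H starting at the identity. *)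
Definition tangent1 (H : set G) : set 'rV[R]_n :=
  [set X | exists gamma : R -> G,
    [/\ continuous gamma, gamma 0 = 1%g, (forall t, H (gamma t)) &
        is_derive (0 : R) (1 : R) (cfun c \o gamma) X]].

End LieAlgebra.

(* A torus is a compact connected abelian Lie subgroup; compact subgroups are
   closed, hence Lie subgroups. *)
Definition is_torus (G : topGroupType) (T : set G) : Prop :=
  [/\ T 1%g /\ (forall x y, T x -> T y -> T (x * y^-1)%g),
      compact T, connected T &
      (forall x y, T x -> T y -> (x * y)%g = (y * x)%g)].

Definition is_maximal_torus (G : topGroupType) (T : set G) : Prop :=
  is_torus T /\ (forall T', is_torus T' -> T `<=` T' -> T' = T).

Section Roots.
Context {R : realType} {n : nat} {G : lieGroupType R n}.
Variable c : chart R n G.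
Variable ip : {dot 'rV[R]_n for (idfun : R -> R)}.

Definition Ad_invariant : Prop :=
  forall (g : G) X Y, ip (Ad c g X) (Ad c g Y) = ip X Y.

Definition orthov2 (U V : {vspace 'rV[R]_n}) : Prop :=
  forall X Y, X \in U -> Y \in V -> ip X Y = 0.

Record root_decomposition (T : set G) (tau : {vspace 'rV[R]_n}) (m : nat)
    (l : 'I_m -> {vspace 'rV[R]_n}) : Prop := RootDecomposition {
  root_sum : (tau + \sum_i l i)%VS = fullv;
  root_ortho_torus : forall i, orthov2 tau (l i);
  root_ortho : forall i j, i != j -> orthov2 (l i) (l j);
  root_dim : forall i, \dim (l i) = 2;
  root_Ad : forall g, T g -> forall i X, X \in l i -> Ad c g X \in l i }.

Definition orthonormal_basis2 (U : {vspace 'rV[R]_n}) (E F : 'rV[R]_n) :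
    Prop :=
  [/\ basis_of U [:: E; F], ip E E = 1, ip F F = 1 & ip E F = 0].

(* The vectors \hat\alpha_i, relative to bases (E_i, F_i) of the root spaces. *)
Definition dual_root (m : nat) (E F : 'I_m -> 'rV[R]_n) (i : 'I_m) :
  'rV[R]_n := lie_bracket c (E i) (F i).

(* The root space of v if v is one of the dual roots +-alpha_k, and 0
   otherwise. *)
Definition root_space (m : nat) (l : 'I_m -> {vspace 'rV[R]_n})
    (alpha : 'I_m -> 'rV[R]_n) (v : 'rV[R]_n) : {vspace 'rV[R]_n} :=
  if [pick k | (v == alpha k) || (v == - alpha k)] is Some k then l k
  else 0%VS.

End Roots.

(* Main.v *)
Require Import Defs.
From HB Require Import structures.
From mathcomp Require Import all_boot all_order all_algebra.
From mathcomp Require Import all_classical all_reals all_analysis.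
From mathcomp Require Import ring lra.
Import Order.TTheory GRing.Theory Num.Theory.
Import numFieldNormedType.Exports.
Local Open Scope classical_set_scope.
Local Open Scope ring_scope.

(** Let < , > be the invariant inner product and tau the Lie algebra of T. An
    element X of tau acts on each plane l i by ad X, which is skew for < , >,
    hence as an infinitesimal rotation, of speed <X, alpha i>. So ad X acts on
    the bracket of l i and l j through the sum and the difference of two such
    rotations: the brackets split into vectors rotated at the speeds
    <X, alpha i + alpha j> and <X, alpha i - alpha j>. The planes l k and tau
    decompose the whole space under this action, and a vector rotated at speed
    <X, b> with b nonzero lies in the sum of the planes whose alpha k is +- b
    (weight_ortho, weight_root_space). It remains to see that at most one plane
    has alpha k = +- b, that is, that the roots are distinct up to sign
    (roots_neq, roots_neq_opp), and that no root vanishes.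

    Distinctness is an argument with norms (no_equal_roots): if alpha i and
    alpha j are equal, certain brackets commute with tau, so they vanish because
    tau is its own centralizer, and then the invariance of < , > gives a negative
    number as a sum of two squares. That tau is its own centralizer follows from
    the absence of zero roots (centralizer_tau).

    That no root vanishes is where maximality of T enters. Suppose that tau
    commutes with E i. First, Ad g fixes E i for every g in T
    (Ad_fixed_of_bracket): the stabilizer of E i in T contains all
    one-parameter subgroups of T, and a closed subgroup of the connected group T
    with that property is T (connected_sub_of_one_parameter). Next, by uniqueness
    of one-parameter subgroups, T commutes with the one-parameter subgroup f of
    velocity E i; the closure of T f(R) is a torus, so it equals T, and E i
    belongs to tau, to which it is orthogonal (tangent_of_Ad_fixed).

    The analysis behind this is built on one estimate for the multiplication in
    a chart at the identity (mul_second_difference). It controls powers of small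
    elements. By compactness of G the powers of elements tending to 1 in the
    direction X have a limit along an ultrafilter, and the estimate shows that
    this limit is a one-parameter subgroup with velocity X
    (one_parameter_limit). This yields at the same time the exponential map and
    the tangent vectors of closed subgroups. The identities of the Lie algebra
    are then obtained by differentiating identities of the group along
    one-parameter subgroups. *)

Set Implicit Arguments.
Unset Strict Implicit.
Unset Printing Implicit Defensive.

(** * Calculus in finite dimension *)

Lemma is_derive_comp_diff {R : realType} {V W : normedModType R} (f : R -> V)
    (g : V -> W) (t : R) (X : V) :
  is_derive t 1 f X -> differentiable g (f t) ->
  is_derive t 1 (g \o f) ('d g (f t) X).
Proof.
move=> df dg.
have dft : differentiable f t by apply/derivable1_diffP; case: df.
have dgf : differentiable (g \o f) t by exact: differentiable_comp.
apply: DeriveDef; first exact/derivable1_diffP.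
rewrite deriveE // diff_comp //=; congr ('d g (f t) _).
by rewrite -deriveE //; exact: derive_val.
Qed.

Lemma is_derive_line {R : realType} {V : normedModType R} (y w : V) (t : R) :
  is_derive t 1 (fun s : R => y + s *: w) w.
Proof.
have E : \forall h \near 0^',
    h^-1 *: (((fun s : R => y + s *: w) \o shift t) (h *: 1) - (y + t *: w)) = w.
  near=> h; rewrite /= [_ *: 1]mulr1 scalerDl opprD addrACA subrr add0r addrK.
  by rewrite scalerK //; near: h; exact: nbhs_dnbhs_neq.
apply: DeriveDef; first exact: is_cvg_near_cst E.
exact: lim_near_cst E.
Unshelve. all: by end_near. Qed.

Lemma coord_norm_le {R : realType} {n : nat} (v : 'rV[R]_n) k : `|v 0 k| <= `|v|.
Proof.
rewrite [leRHS]/Num.Def.normr/= mx_normrE.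
exact: (le_bigmax _ (fun i : 'I_1 * 'I_n => `|v i.1 i.2|) (0, k)).
Qed.

Lemma norm_le_coord {R : realType} {n : nat} (v : 'rV[R]_n) M :
  0 <= M -> (forall k, `|v 0 k| <= M) -> `|v| <= M.
Proof.
move=> M0 vM; rewrite [leLHS]/Num.Def.normr/= mx_normrE.
by apply: bigmax_le => // -[i k] _ /=; rewrite ord1.
Qed.

(** The mean value theorem holds coordinatewise; the norm of a row vector is
    the largest absolute value of its coordinates. *)
Lemma mean_value_le {R : realType} {V : normedModType R} {n : nat}
    (f : V -> 'rV[R]_n) (x y : V) (M : R) : 0 <= M ->
  (forall t : R, 0 <= t <= 1 -> differentiable f (y + t *: (x - y))) ->
  (forall t : R, 0 <= t <= 1 -> `|'D_(x - y) f (y + t *: (x - y))| <= M) ->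
  `|f x - f y| <= M.
Proof.
move=> M0 df fM; apply: norm_le_coord => // k.
pose p (t : R) : V := y + t *: (x - y).
have dp (t : R) : is_derive t (1 : R) p (x - y).
  exact: is_derive_line.
pose F (t : R) : R := (f (p t)) 0 k.
have dF (t : R) : 0 <= t <= 1 -> is_derive t (1 : R) F (('D_(x - y) f (p t)) 0 k).
  move=> t01; have := is_derive_comp_diff (dp t) (df t t01).
  rewrite -deriveE; last exact: df.
  move=> [/derivable_mxP dfp <-]; apply: DeriveDef; first exact: dfp.
  by rewrite derive_mx ?mxE//; exact/derivable_mxP.
have [||c c01 Fc] := @MVT R F (fun t => ('D_(x - y) f (p t)) 0 k) 0 1 ltr01.
- by move=> t; rewrite in_itv/= => /andP[/ltW t0 /ltW t1]; apply: dF; rewrite t0.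
- apply: derivable_within_continuous => t; rewrite in_itv/= => t01.
  by have [] := dF t t01.
rewrite !mxE; have -> : f x 0 k - f y 0 k = F 1 - F 0.
  by rewrite /F /p scale0r addr0 scale1r [y + (x - y)]addrC subrK.
rewrite Fc subr0 mulr1; apply: (le_trans (coord_norm_le _ _)); apply: fM.
by move: c01; rewrite in_itv/= => /andP[/ltW-> /ltW->].
Qed.

Lemma norm_segment_lt {R : realType} {V : normedModType R} (x y o : V) (r t : R) :
  0 <= t <= 1 -> `|x - o| < r -> `|y - o| < r -> `|y + t *: (x - y) - o| < r.
Proof.
move=> /andP[t0 t1] xr yr.
have -> : y + t *: (x - y) - o = t *: (x - o) + (1 - t) *: (y - o).
  by rewrite scalerBl scale1r addrCA -scalerBr opprB addrA subrK addrAC.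
apply: le_lt_trans (ler_normD _ _) _.
rewrite !normrZ (ger0_norm t0) ger0_norm ?subr_ge0//.
move: t0; rewrite le_eqVlt => /orP[/eqP <-|t0]; first
  by rewrite mul0r subr0 mul1r add0r.
rewrite -[ltRHS](mul1r r) -{2}(subrKC t 1) [ltRHS]mulrDl ltr_leD// ?ltr_pM2l//.
by rewrite ler_wpM2l ?subr_ge0// ltW.
Qed.

Lemma row_sum_pair0 {R : realType} {n : nat} (w : 'rV[R]_n) :
  ((w, 0) : 'rV[R]_n * 'rV[R]_n) = \sum_i w 0 i *: (delta_mx 0 i, 0).
Proof.
rewrite [in LHS](row_sum_delta w).
elim/big_ind2 : _ => // [x1 x2 y1 y2 <- <-|i _].
  by rewrite -[RHS]/(x2 + y2, 0 + 0) addr0.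
by rewrite -[RHS]/(_ *: _, _ *: 0) scaler0.
Qed.

Lemma row_sum_pair1 {R : realType} {n : nat} (w : 'rV[R]_n) :
  ((0, w) : 'rV[R]_n * 'rV[R]_n) = \sum_i w 0 i *: (0, delta_mx 0 i).
Proof.
rewrite [in LHS](row_sum_delta w).
elim/big_ind2 : _ => // [x1 x2 y1 y2 <- <-|i _].
  by rewrite -[RHS]/(0 + 0, x2 + y2) addr0.
by rewrite -[RHS]/(_ *: 0, _ *: _) scaler0.
Qed.

Lemma differentiable_pairl {R : realType} {U V : normedModType R}
    (u : U) (v : V) :
  differentiable (fun y : U => (y, v)) u.
Proof.
have di := @ex_diff _ _ _ _ _ _ _ (is_diff_id u).
exact: (differentiable_pair di (differentiable_cst v u)).
Qed.

Lemma differentiable_pairr {R : realType} {U V : normedModType R}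
    (u : U) (v : V) :
  differentiable (fun y : V => (u, y)) v.
Proof.
have di := @ex_diff _ _ _ _ _ _ _ (is_diff_id v).
exact: (differentiable_pair (differentiable_cst u v) di).
Qed.

Lemma derive_pairl {R : realType} {U V W : normedModType R} (f : U * V -> W)
  (u w : U) (v : V) : 'D_w (fun y => f (y, v)) u = 'D_(w, 0) f (u, v).
Proof.
suff E : (fun h : R =>
      h^-1 *: (((fun z => f (z, v)) \o shift u) (h *: w) - f (u, v)))
    = (fun h : R => h^-1 *: ((f \o shift (u, v)) (h *: (w, 0)) - f (u, v))).
  by rewrite /derive E.
apply/funext => h /=.
by rewrite -[h *: (w, 0) + (u, v)]/(h *: w + u, h *: 0 + v) scaler0 add0r.
Qed.

Lemma derive_pairr {R : realType} {U V W : normedModType R} (f : U * V -> W)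
  (u : U) (v w : V) : 'D_w (fun y => f (u, y)) v = 'D_(0, w) f (u, v).
Proof.
suff E : (fun h : R =>
      h^-1 *: (((fun z => f (u, z)) \o shift v) (h *: w) - f (u, v)))
    = (fun h : R => h^-1 *: ((f \o shift (u, v)) (h *: (0, w)) - f (u, v))).
  by rewrite /derive E.
apply/funext => h /=.
by rewrite -[h *: (0, w) + (u, v)]/(h *: 0 + u, h *: w + v) scaler0 add0r.
Qed.

Section second_difference.
Context {R : realType} {n : nat}.
Local Notation V := 'rV[R]_n.
Variables (f : V * V -> V) (U : set (V * V)) (o : V * V).
Hypotheses (oU : open U) (Uo : U o) (f2 : Ck 2 U f).

Let df p : U p -> differentiable f p. Proof. exact: f2.1. Qed.
Let ddf v p : U p -> differentiable ('D_v f) p.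
Proof. exact: (f2.2 v).1. Qed.
Let cddf v w p : U p -> {for p, continuous ('D_w ('D_v f))}.
Proof. exact: (f2.2 v).2. Qed.

Let e (i : 'I_n) : V := delta_mx 0 i.
Let D i j p := 'D_(0, e j) ('D_(e i, 0) f) p.

Lemma mixed_derivative_bilinear (v w : V) p : U p ->
  'D_(0, v) ('D_(w, 0) f) p = \sum_i \sum_j (w 0 i * v 0 j) *: D i j p.
Proof.
move=> Up.
have E : \near p, 'D_(w, 0) f p = (\sum_i w 0 i *: 'D_(e i, 0) f) p.
  have : nbhs p U by exact: open_nbhs_nbhs.
  apply: filterS => q Uq; rewrite fct_sumE deriveE; last exact: df.
  rewrite row_sum_pair0 linear_sum; apply: eq_bigr => i _.
  by rewrite linearZ /= -deriveE//; exact: df.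
rewrite (near_eq_derive _ E) derive_sum; last first.
  by move=> i; apply: derivableZ; apply: diff_derivable; exact: ddf.
apply: eq_bigr => i _; rewrite deriveZ; last first.
  by apply: diff_derivable; exact: ddf.
rewrite deriveE; last exact: ddf.
rewrite row_sum_pair1 linear_sum scaler_sumr; apply: eq_bigr => j _.
by rewrite linearZ /= -deriveE ?scalerA//; exact: ddf.
Qed.

(** The finitely many coefficients of the bilinear form are continuous at o,
    hence bounded near o. *)
Lemma mixed_derivative_bound : exists C r, [/\ 0 <= C, 0 < r &
  forall p : V * V, `|p.1 - o.1| < r -> `|p.2 - o.2| < r -> U p /\
   forall v w, `|'D_(0, v) ('D_(w, 0) f) p| <= C * `|w| * `|v|].
Proof.
pose M i j := `|D i j o| + 1.
pose small p := forall ij : 'I_n * 'I_n, `|D ij.1 ij.2 p| <= M ij.1 ij.2.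
have nM : nbhs o small.
  have FF : Filter (nbhs o) by exact: nbhs_filter.
  apply: (@filter_forall _ _
    (fun ij p => `|D ij.1 ij.2 p| <= M ij.1 ij.2) _ FF) => -[i j] /=.
  have : (fun p => `|D i j p|) @ o --> `|D i j o|.
    by apply: cvg_norm; exact: cddf.
  move=> /cvgr_le; apply; rewrite /M ltrDl; exact: ltr01.
have nU : nbhs o U by exact: open_nbhs_nbhs.
have nUM : nbhs o (U `&` small) by exact: filterI.
move: nUM => /nbhs_ballP [r /= r0 rP].
exists (\sum_i \sum_j M i j), r; split => //.
  by apply: sumr_ge0 => i _; apply: sumr_ge0 => j _; rewrite addr_ge0.
move=> p p1 p2.
have [Up Mp] : (U `&` small) p.
  by apply: rP; split; rewrite -ball_normE /= distrC.
split=> // v w; rewrite mixed_derivative_bilinear// !mulr_suml.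
apply: (le_trans (ler_norm_sum _ _ _)); apply: ler_sum => i _.
rewrite !mulr_suml.
apply: (le_trans (ler_norm_sum _ _ _)); apply: ler_sum => j _.
rewrite normrZ normrM mulrC -mulrA ler_pM ?mulr_ge0//; first exact: (Mp (i, j)).
by rewrite ler_pM// coord_norm_le.
Qed.

(** Two applications of the mean value inequality: in the first variable to
    z |-> f (z, a) - f (z, b), whose derivative is itself an increment, in the
    second variable, of a partial derivative of f. *)
Lemma second_difference_le : exists C r, [/\ 0 <= C, 0 < r &
  forall x y a b : V, `|x - o.1| < r -> `|y - o.1| < r ->
    `|a - o.2| < r -> `|b - o.2| < r ->
    U (x, a) /\
    `|(f (x, a) - f (x, b)) - (f (y, a) - f (y, b))| <=
      C * `|x - y| * `|a - b|].
Proof.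
have [C [r [C0 r0 H]]] := mixed_derivative_bound.
exists C, r; split=> // x y a b xr yr ar br; split; first by case: (H (x, a)).
pose g (z : V) := f (z, a) - f (z, b).
have dg1 (z c : V) : `|z - o.1| < r -> `|c - o.2| < r ->
    differentiable (fun z => f (z, c)) z.
  move=> zr cr; apply: (@differentiable_comp _ _ _ _ (fun z => (z, c)) f).
    exact: differentiable_pairl.
  by have [Uzc _] := H (z, c) zr cr; exact: (df Uzc).
apply: (@mean_value_le _ _ _ g x y) => [|t t01|t t01]; first by rewrite !mulr_ge0.
  apply: differentiableB; apply: dg1 => //; exact: norm_segment_lt.
set z := y + _; have zr : `|z - o.1| < r by exact: norm_segment_lt.
have -> : 'D_(x - y) g z = 'D_(x - y, 0) f (z, a) - 'D_(x - y, 0) f (z, b).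
  by rewrite -!(derive_pairl f) deriveB//; apply: diff_derivable; apply: dg1.
have E (t' : R) : (z, b) + t' *: ((z, a) - (z, b)) = (z, b + t' *: (a - b)).
  by rewrite -[LHS]/(z + t' *: (z - z), _) subrr scaler0 addr0.
apply: (@mean_value_le _ _ _ ('D_(x - y, 0) f) (z, a) (z, b)).
- by rewrite !mulr_ge0.
- move=> s s01; rewrite E.
  have [//||Us _] := H (z, b + s *: (a - b)); first exact: norm_segment_lt.
  exact: (ddf _ Us).
- move=> s s01; rewrite E -[(z, a) - (z, b)]/(z - z, a - b) subrr.
have [//|/= |_] := H (z, b + s *: (a - b)); first exact: norm_segment_lt.
exact.
Qed.

End second_difference.

Lemma near_eq_differentiable {R : realType} {V W : normedModType R}
    (f g : V -> W) (x : V) :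
  (\forall y \near x, f y = g y) -> differentiable f x -> differentiable g x.
Proof.
move=> fg df; have gx := nbhs_singleton fg.
have E : g \o shift x = cst (g x) + 'd f x +o_ 0 id.
  apply/eqaddoP => e e0.
  have /eqaddoP/(_ e e0) fe := diff_locally df.
  have shift_cvg : h + x @[h --> (0 : V)] --> x.
    by rewrite -{2}(add0r x); apply: cvgD; [exact: cvg_id|exact: cvg_cst].
  have fg0 : \forall h \near (0 : V), f (h + x) = g (h + x).
    exact: (shift_cvg _ fg).
  apply: filter_app fe; apply: filterS fg0 => h fgh.
  by rewrite !fctE /= fgh gx.
have dE : 'd g x = 'd f x :> (V -> W).
  by apply: diff_unique E; exact: diff_continuous.
by apply/diff_locallyP; rewrite dE; split=> //; exact: diff_continuous.
Qed.

Lemma differentiable_scale {R : realType} {V : normedModType R} {n : nat}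
    (k : V -> R) (f : V -> 'rV[R]_n) (x : V) :
  differentiable k x -> differentiable f x ->
  differentiable (fun y => k y *: f y) x.
Proof.
move=> dk df.
have -> : (fun y => k y *: f y) =
    \sum_(i < n) (fun y => (k y * f y 0 i) *: (delta_mx 0 i : 'rV[R]_n)).
  apply/funext => y; rewrite fct_sumE [in LHS](row_sum_delta (f y)) scaler_sumr.
  by apply: eq_bigr => i _; rewrite scalerA.
apply: differentiable_sum => i.
have dfi : differentiable (fun y => f y 0 i : R) x.
  exact: (@differentiable_comp _ _ _ _ f (fun v : 'rV[R]_n => v 0 i) x df
    (differentiable_coord _ _ _)).
have dkf : differentiable (fun y => k y * f y 0 i : R) x.
  exact: (@differentiableM _ _ k (fun y => f y 0 i) x dk dfi).
exact: (@differentiableZl _ _ _ _ (delta_mx 0 i : 'rV[R]_n) x dkf).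
Qed.

(** * The group law in a chart at the identity *)

Section chart_at_identity.
Context {R : realType} {n : nat} {G : lieGroupType R n}.
Implicit Types (c : chart R n G) (x y a b : G).

Lemma Ck_subset (V W : normedModType R) k (A B : set V) (f : V -> W) :
  A `<=` B -> Ck k B f -> Ck k A f.
Proof.
elim: k f => [|k IHk] f AB /=; first by move=> fB x /AB/fB.
by move=> [fB DfB]; split=> [x /AB/fB//|v]; exact: IHk (DfB v).
Qed.

(** Coordinates centred so that the identity has coordinate 0. *)
Definition ccoord c x := cfun c x - cfun c 1%g.

Definition cball c (r : R) : set G := [set x | cdom c x /\ `|ccoord c x| < r].

Lemma atlas_cinvK c x : atlas c -> cdom c x -> cinv c (cfun c x) = x.
Proof. by move=> /atlas_chart[_ _ + _ _]; exact. Qed.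

Lemma atlas_cfun_continuous c x :
  atlas c -> cdom c x -> {for x, continuous (cfun c)}.
Proof. by move=> /atlas_chart[_ _ _ + _]; exact. Qed.

Lemma atlas_cinv_continuous c x :
  atlas c -> cdom c x -> {for cfun c x, continuous (cinv c)}.
Proof. by move=> /atlas_chart[_ _ _ _ H] cx; apply: H; exists x. Qed.

Lemma nbhs_cdom c x : atlas c -> cdom c x -> nbhs x (cdom c).
Proof. by move=> /atlas_chart[oc _ _ _ _] cx; exact: open_nbhs_nbhs. Qed.

Lemma nbhs_cimg c x : atlas c -> cdom c x -> nbhs (cfun c x) (cimg c).
Proof.
move=> /atlas_chart[_ oc _ _ _] cx; apply: open_nbhs_nbhs; split => //.
by exists x.
Qed.

Lemma ccoord1 c : ccoord c 1%g = 0. Proof. exact: subrr. Qed.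

Lemma cball1 c r : cdom c 1%g -> 0 < r -> cball c r 1%g.
Proof. by move=> c1 r0; split; rewrite // ccoord1 normr0. Qed.

Lemma ccoord_inj c x y : atlas c -> cdom c x -> cdom c y ->
  ccoord c x = ccoord c y -> x = y.
Proof.
move=> ca cx cy /addIr xy.
by rewrite -(atlas_cinvK ca cx) xy atlas_cinvK.
Qed.

Lemma ccoord_continuous c x : atlas c -> cdom c x ->
  ccoord c y @[y --> x] --> ccoord c x.
Proof.
move=> ca cx; apply: cvgB; last exact: cvg_cst.
exact: atlas_cfun_continuous.
Qed.

Lemma nbhs1_cball c r : chart_at1 c -> 0 < r -> nbhs (1%g : G) (cball c r).
Proof.
move=> [ca c1] r0; apply: filterI; first exact: nbhs_cdom.
have := ccoord_continuous ca c1; rewrite ccoord1 => /cvgr0_norm_lt; exact.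
Qed.

Lemma cball_nbhs1 c N : chart_at1 c -> nbhs (1%g : G) N ->
  exists2 r, 0 < r & cball c r `<=` N.
Proof.
move=> [ca c1] N1.
have : nbhs (cfun c 1%g) (cinv c @^-1` N).
  by apply: (atlas_cinv_continuous ca c1); rewrite atlas_cinvK.
move=> /nbhs_ballP [r r0 rN]; exists r => // x [cx xr].
rewrite -(atlas_cinvK ca cx); apply: rN.
by rewrite -ball_normE /= distrC.
Qed.

Lemma mul_nbhs (x y : G) N : nbhs (x * y)%g N ->
  nbhs (x, y) [set p : G * G | N (p.1 * p.2)%g].
Proof. by move=> /(@mulg_continuous G (x, y)). Qed.

(** The only consequence of smoothness of the multiplication that the
    construction of one-parameter subgroups uses. Taking y or b to be the
    identity, it says that x a has coordinate x + a up to O(|x| |a|), and that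
    translations distort differences of coordinates by a factor close to 1. *)
Lemma mul_second_difference c : chart_at1 c -> exists C r, [/\ 0 <= C, 0 < r &
  forall x y a b, cball c r x -> cball c r y -> cball c r a -> cball c r b ->
    cdom c (x * a)%g /\
    `|(ccoord c (x * a)%g - ccoord c (x * b)%g) -
      (ccoord c (y * a)%g - ccoord c (y * b)%g)| <=
    C * `|ccoord c x - ccoord c y| * `|ccoord c a - ccoord c b|].
Proof.
move=> [ca c1]; set o := cfun c 1%g.
have /(_ 2) muS := @mulg_smooth _ _ G c c c ca ca ca.
set U := (X in Ck 2 X _) in muS; set mu := (X in Ck 2 _ X) in muS.
have Uo : nbhs (o, o) U.
  have co1 : cinv c o = 1%g by exact: atlas_cinvK.
  have F1 : nbhs (o, o) [set p | cimg c p.1] by apply: cvg_fst; exact: nbhs_cimg.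
  have F2 : nbhs (o, o) [set p | cimg c p.2] by apply: cvg_snd; exact: nbhs_cimg.
  have F3 : nbhs (o, o) [set p | cdom c (cinv c p.1 * cinv c p.2)%g].
    have cvg1 : cinv c p.1 @[p --> (o, o)] --> (1 : G)%g.
      rewrite -co1; apply: cvg_comp; first exact: cvg_fst.
      exact: atlas_cinv_continuous.
    have cvg2 : cinv c p.2 @[p --> (o, o)] --> (1 : G)%g.
      rewrite -co1; apply: cvg_comp; first exact: cvg_snd.
      exact: atlas_cinv_continuous.
    have cvg12 := cvg_pair cvg1 cvg2.
    have N1 : nbhs ((1, 1)%g : G * G) [set p : G * G | cdom c (p.1 * p.2)%g].
      by apply: mul_nbhs; rewrite mulg1; exact: nbhs_cdom.
    exact: (cvg12 _ _ _ _ N1).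
  by apply: filterS (filterI (filterI F1 F2) F3) => p [[]].
have [//||C [r [C0 r0 H]]] :=
  @second_difference_le R n mu U° (o, o) (open_interior _).
  by apply: Ck_subset muS; exact: interior_subset.
exists C, r; split=> // x y a b [cx xr] [cy yr] [aa ar] [cb br].
have [/interior_subset[_ _ /=]] :=
  H (cfun c x) (cfun c y) (cfun c a) (cfun c b) xr yr ar br.
rewrite !atlas_cinvK// => cxa; split=> //; move: b0.
rewrite /mu /= !atlas_cinvK// /ccoord.
by rewrite !opprB ![_ + (o - _)]addrA !subrK.
Qed.

End chart_at_identity.

Lemma subrACA (V : zmodType) (x y z t : V) : (x - y) - (z - t) = (x - z) - (y - t).
Proof. by rewrite !opprB addrACA [- y - z]addrC -addrACA. Qed.

(** * Powers of elements near the identity *)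

(** The smallness conditions under which the estimates below survive j
    multiplications, as long as j |a| <= d. *)
Lemma exists_pow_radius {R : realType} (C r : R) : 0 <= C -> 0 < r ->
  exists d, [/\ 0 < d, 4 * d <= r & 4 * C * d <= 1].
Proof.
move=> C0 r0; have C1 : 0 < 4 * C + 1 by rewrite ltr_pwDr// mulr_ge0.
exists (Num.min (r / 4) (4 * C + 1)^-1); set d := Num.min _ _.
have d0 : 0 < d by rewrite /d !lt_min !divr_gt0// invr_gt0 C1.
split=> //.
  have : d <= r / 4 by rewrite /d !ge_min lexx.
  lra.
have : (4 * C + 1) * d <= 1.
  by rewrite -ler_pdivlMl// mulr1 /d !ge_min lexx orbT.
lra.
Qed.

Section powers.
Context {R : realType} {n : nat} {G : lieGroupType R n}.
Variables (c : chart R n G) (C r : R).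

Definition mul_estimate := forall x y a b : G,
  cball c r x -> cball c r y -> cball c r a -> cball c r b ->
  cdom c (x * a)%g /\
  `|(ccoord c (x * a)%g - ccoord c (x * b)%g) -
    (ccoord c (y * a)%g - ccoord c (y * b)%g)| <=
  C * `|ccoord c x - ccoord c y| * `|ccoord c a - ccoord c b|.

Hypotheses (cdom1 : cdom c 1%g) (C0 : 0 <= C) (r0 : 0 < r) (K : mul_estimate).
Variable d : R.
Hypotheses (dr : 4 * d <= r) (dC : 4 * C * d <= 1).

Lemma mul_diff_left x y a : cball c r x -> cball c r y -> cball c r a ->
  `|(ccoord c (x * a)%g - ccoord c (y * a)%g) - (ccoord c x - ccoord c y)| <=
  C * `|ccoord c x - ccoord c y| * `|ccoord c a|.
Proof.
move=> bx bY ba; have [_] := K bx bY ba (cball1 cdom1 r0).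
by rewrite !mulg1 ccoord1 subr0 subrACA.
Qed.

Lemma mul_diff_right x a b : cball c r x -> cball c r a -> cball c r b ->
  `|(ccoord c (x * a)%g - ccoord c (x * b)%g) - (ccoord c a - ccoord c b)| <=
  C * `|ccoord c x| * `|ccoord c a - ccoord c b|.
Proof.
move=> bx ba bb; have [_] := K bx (cball1 cdom1 r0) ba bb.
by rewrite !mul1g ccoord1 subr0.
Qed.

Lemma mul_diff x a : cball c r x -> cball c r a ->
  `|ccoord c (x * a)%g - (ccoord c x + ccoord c a)| <=
  C * `|ccoord c x| * `|ccoord c a|.
Proof.
move=> bx ba; have := mul_diff_right bx ba (cball1 cdom1 r0).
by rewrite mulg1 ccoord1 subr0 -addrA -opprD.
Qed.

(** Each multiplication by a adds a to the coordinate with an error at most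
    C (2 j |a|) |a|, and these errors sum to C (j |a|)^2. *)
Lemma pow_estimate a j : cdom c a -> j%:R * `|ccoord c a| <= d ->
  [/\ cball c r (a ^+ j)%g,
      `|ccoord c (a ^+ j)%g| <= 2 * (j%:R * `|ccoord c a|) &
      `|ccoord c (a ^+ j)%g - j%:R *: ccoord c a| <=
        C * (j%:R * `|ccoord c a|) ^+ 2].
Proof.
move=> ca; set A := `|ccoord c a|; have A0 : 0 <= A by exact: normr_ge0.
move: (dr) (dC) (r0) (C0) => dr' dC' r0' C0'.
elim: j => [|j IHj] jd.
  rewrite expg0 ccoord1 normr0 !mul0r scale0r subr0 normr0.
  by split; [exact: cball1|rewrite mulr0|rewrite expr0n/= mulr0].
have J0 : 0 <= j%:R :> R by exact: ler0n.
rewrite -natr1 mulrDl mul1r in jd *.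
have JA0 : 0 <= j%:R * A by rewrite mulr_ge0.
have [|bj aj ej] := IHj; first by lra.
have d0 : 0 <= d by lra.
have ba : cball c r a.
  split=> //; rewrite -/A; lra.
have m := mul_diff bj ba; rewrite -/A -expgSr in m.
have [cj _] := K bj bj ba ba; rewrite -expgSr in cj.
set P := ccoord c (a ^+ j.+1)%g in m *.
set Q := ccoord c (a ^+ j)%g in aj ej m.
have m' : `|P - (Q + ccoord c a)| <= C * (2 * (j%:R * A)) * A.
  by apply: (le_trans m); rewrite ler_wpM2r// ler_wpM2l.
have nP : `|P| <= 2 * (j%:R * A + A).
  have -> : P = (P - (Q + ccoord c a)) + (Q + ccoord c a) by rewrite subrK.
  have := ler_normD (P - (Q + ccoord c a)) (Q + ccoord c a).
  have := ler_normD Q (ccoord c a); rewrite -/A.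
  have : C * (j%:R * A) * A <= C * d * A by rewrite ler_wpM2r// ler_wpM2l//; lra.
  have : 4 * C * d * A <= A by rewrite ler_piMl.
  lra.
split=> //.
  split=> //; rewrite -/P; lra.
have -> : P - (j%:R + 1) *: ccoord c a =
    (P - (Q + ccoord c a)) + (Q - j%:R *: ccoord c a).
  rewrite [Q + _]addrC opprD [P + (_ - Q)]addrA subrKA.
  by rewrite scalerDl scale1r [_ + ccoord c a]addrC opprD addrA.
apply: le_trans (ler_normD _ _) _.
have : 0 <= C * A ^+ 2 by rewrite mulr_ge0// exprn_ge0.
move: m' ej; rewrite !expr2; nra.
Qed.

(** The j-th powers of a and b are compared by replacing one factor at a time;
    this is what makes one-parameter subgroups unique. *)
Lemma pow_diff_estimate a b j : cdom c a -> cdom c b ->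
  j%:R * `|ccoord c a| <= d -> j%:R * `|ccoord c b| <= d ->
  `|ccoord c (a ^+ j)%g - ccoord c (b ^+ j)%g| <=
  2 * (j%:R * `|ccoord c a - ccoord c b|).
Proof.
move=> ca cb; set A := `|ccoord c a|; set B := `|ccoord c b|.
set D := `|ccoord c a - _|.
have A0 : 0 <= A by exact: normr_ge0.
have B0 : 0 <= B by exact: normr_ge0.
have D0 : 0 <= D by exact: normr_ge0.
move: (dr) (dC) (r0) (C0) => dr' dC' r0' C0'.
elim: j => [|j IHj]; first by rewrite !expg0 subrr normr0 !mulr_ge0.
have J0 : 0 <= j%:R :> R by exact: ler0n.
rewrite -natr1 !mulrDl !mul1r => ja jb.
have JA0 : 0 <= j%:R * A by rewrite mulr_ge0.
have JB0 : 0 <= j%:R * B by rewrite mulr_ge0.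
have [||bja aja _] := @pow_estimate a j; [by []|by rewrite -/A; lra|].
have [||bjb ajb _] := @pow_estimate b j; [by []|by rewrite -/B; lra|].
have ba : cball c r a by split=> //; rewrite -/A; lra.
have bb : cball c r b by split=> //; rewrite -/B; lra.
have {}IHj := IHj ltac:(lra) ltac:(lra).
have m1 := mul_diff_left bja bjb ba; have m2 := mul_diff_right bjb ba bb.
rewrite -!expgSr -/A -/D in m1 m2 *.
set X := ccoord c (a ^+ j)%g in IHj aja m1.
set Y := ccoord c (b ^+ j)%g in IHj ajb m1 m2.
set X' := ccoord c (a ^+ j.+1)%g in m1 *; set Y' := ccoord c (b ^+ j.+1)%g in m2 *.
set Z := ccoord c (b ^+ j * a)%g in m1 m2.
have -> : X' - Y' = (X' - Z - (X - Y)) + (Z - Y' - (ccoord c a - ccoord c b)) +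
   ((X - Y) + (ccoord c a - ccoord c b)).
  by rewrite [X in _ = X + _]addrACA -opprD subrK subrKA.
have := ler_normD (X' - Z - (X - Y) + (Z - Y' - (ccoord c a - ccoord c b)))
  (X - Y + (ccoord c a - ccoord c b)).
have := ler_normD (X' - Z - (X - Y)) (Z - Y' - (ccoord c a - ccoord c b)).
have := ler_normD (X - Y) (ccoord c a - ccoord c b).
rewrite -/D.
have m1' : C * `|X - Y| * A <= C * (2 * (j%:R * D)) * A.
  by rewrite ler_wpM2r// ler_wpM2l.
have m2' : C * `|Y| * D <= C * (2 * (j%:R * B)) * D.
  by rewrite ler_wpM2r// ler_wpM2l.
have : C * (j%:R * A) * D <= C * d * D by rewrite ler_wpM2r// ler_wpM2l//; lra.
have : C * (j%:R * B) * D <= C * d * D by rewrite ler_wpM2r// ler_wpM2l//; lra.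
have : 4 * C * d * D <= D by rewrite ler_piMl.
lra.
Qed.

End powers.

(** * One-parameter subgroups as limits of powers *)

Section integer_powers.
Variable G : groupType.
Implicit Type a : G.

Definition zpow a (z : int) : G :=
  match z with Posz k => (a ^+ k)%g | Negz k => (a ^- k.+1)%g end.

Lemma zpow_opp a (k : nat) : zpow a (- k%:Z) = (a ^- k)%g.
Proof. by case: k => [|k]; rewrite ?expg0 ?invg1// NegzE. Qed.

Lemma zpowS a z : zpow a (z + 1) = (zpow a z * a)%g.
Proof.
case: z => k; first by rewrite -PoszD addn1 /= expgSr.
rewrite NegzE -addn1 PoszD opprD subrK zpow_opp -[X in zpow a X]opprD -PoszD.
by rewrite zpow_opp addn1 expgS invgM mulgVK.
Qed.

Lemma zpowD a y z : zpow a (y + z) = (zpow a y * zpow a z)%g.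
Proof.
elim/int_rect: z => [|k IHk|k IHk]; first by rewrite addr0 /= expg0 mulg1.
  by rewrite -addn1 PoszD addrA !zpowS IHk mulgA.
apply: (@mulIg _ a); rewrite -mulgA -!zpowS -addrA -addn1 PoszD opprD subrK.
exact: IHk.
Qed.

End integer_powers.

Lemma ultra_fmap (I J : Type) (F : set_system I) (g : I -> J) :
  UltraFilter F -> UltraFilter (g @ F).
Proof.
move=> FU; apply: Build_UltraFilter => H HH FH.
apply/seteqP; split=> [B HB|]; last exact: FH.
have [//|FnB] := in_ultra_setVsetC (g @^-1` B) FU.
have HnB : H (~` B) by apply: FH.
have : H (B `&` ~` B) by exact: filterI.
by rewrite setICr => /filter_ex[].
Qed.

Lemma is_derive0P {R : realType} {V : normedModType R} (f : R -> V) (X : V) :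
  is_derive (0 : R) 1 f X <-> h^-1 *: (f h - f 0) @[h --> 0^'] --> X.
Proof.
have E : (fun h : R => h^-1 *: ((f \o shift 0) (h *: 1) - f 0)) =
         (fun h => h^-1 *: (f h - f 0)).
  by apply/funext => h /=; rewrite addr0 [_ *: 1]mulr1.
split=> [[/cvg_ex[l fl] <-]|fX]; last first.
  apply: DeriveDef; first by apply/cvg_ex; exists X; rewrite E.
  by apply: cvg_lim => //; rewrite E.
by rewrite /derive -E (cvg_lim _ fl)// -E.
Qed.

Lemma is_derive0_quadratic {R : realType} {V : normedModType R} (f : R -> V)
    (X : V) (M d : R) : 0 < d ->
  (forall t, `|t| < d -> `|f t - f 0 - t *: X| <= M * t ^+ 2) ->
  is_derive (0 : R) 1 f X.
Proof.
move=> d0 fM; apply/is_derive0P; apply/cvgrPdist_le => e e0.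
have M0 : 0 < `|M| + 1 by rewrite ltr_pwDr.
near=> h.
have h0 : h != 0 by near: h; exact: nbhs_dnbhs_neq.
have hd : `|h| < d by near: h; exact: dnbhs0_lt.
have he : `|h| <= e / (`|M| + 1).
  by near: h; apply: dnbhs0_le; rewrite divr_gt0.
rewrite distrC -[X in _ - X](scalerK h0) -scalerBr normrZ normfV.
rewrite ler_pdivrMl ?normr_gt0//; apply: (le_trans (fM h hd)).
rewrite -[h ^+ 2]real_normK ?num_real// expr2 mulrA mulrC ler_wpM2l//.
apply: (@le_trans _ _ ((`|M| + 1) * `|h|)).
  by rewrite ler_wpM2r// (le_trans (ler_norm M))// lerDl.
by rewrite mulrC -ler_pdivlMr.
Unshelve. all: by end_near. Qed.

Section one_parameter_subgroups.
Context {R : realType} {n : nat} {G : lieGroupType R n}.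
Implicit Types (c : chart R n G) (f : R -> G).

Lemma mulg_cvg (I : Type) (F : set_system I) {FF : Filter F} (u v : I -> G) x y :
  u @ F --> x -> v @ F --> y -> (u i * v i)%g @[i --> F] --> (x * y)%g.
Proof.
move=> ux vy.
exact: (@cvg_comp _ _ _ (fun i => (u i, v i)) _ F _ _
  (cvg_pair ux vy) (@mulg_continuous G (x, y))).
Qed.

Lemma invg_cvg (I : Type) (F : set_system I) {FF : Filter F} (u : I -> G) x :
  u @ F --> x -> (u i)^-1%g @[i --> F] --> x^-1%g.
Proof. by move=> ux; exact: (cvg_comp _ _ ux (@invg_continuous G x)). Qed.

Definition one_param f :=
  (forall s t, f (s + t) = (f s * f t)%g) /\ continuous f.

Lemma hom_at0 f : (forall s t, f (s + t) = (f s * f t)%g) -> f 0 = 1%g.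
Proof. by move=> fD; apply: (@mulgI _ (f 0)); rewrite -fD addr0 mulg1. Qed.

Lemma hom_opp f t : (forall s t, f (s + t) = (f s * f t)%g) -> f (- t) = (f t)^-1%g.
Proof.
move=> fD; apply: (@mulgI _ (f t)).
by rewrite -fD subrr hom_at0// mulgV.
Qed.

Lemma nbhs1_inv (N : set G) : nbhs (1 : G)%g N -> nbhs (1 : G)%g [set x | N x^-1%g].
Proof. by move=> N1; apply: (@invg_continuous G 1%g); rewrite invg1. Qed.

(** Negative times are reached through inverses: f (- t) is the inverse of f t,
    and the coordinate of an inverse is the opposite coordinate up to a quadratic
    error, because x^-1 x has coordinate 0. *)
Lemma hom_velocity c f (X : 'rV[R]_n) (M d : R) : chart_at1 c ->
  (forall s t, f (s + t) = (f s * f t)%g) -> 0 < d ->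
  (forall t, 0 <= t < d ->
    cdom c (f t) /\ `|ccoord c (f t) - t *: X| <= M * t ^+ 2) ->
  continuous f /\ is_derive (0 : R) 1 (cfun c \o f) X.
Proof.
move=> c1 fD d0 fM; have [C [r [C0 r0 K]]] := mul_second_difference c1.
have [rho rho0 inv_rho] := cball_nbhs1 c1 (nbhs1_inv (nbhs1_cball c1 r0)).
pose L := `|X| + `|M| + 1; have L0 : 0 < L by rewrite ltr_pwDr// addr_ge0.
pose N := 2 * C * L ^+ 2 + `|M|.
(* For t < e, t L bounds the coordinate of f t and is small against rho (which
   puts the inverse of f t in the ball), r and 1 / C. *)
pose e := Num.min (Num.min d 1)
  (Num.min (Num.min (rho / L) (r / L)) (2 * C * L + 1)^-1).
have CL0 : 0 < 2 * C * L + 1 by rewrite ltr_pwDr// !mulr_ge0// ltW.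
have e0 : 0 < e by rewrite /e !lt_min d0 ltr01 !divr_gt0//= invr_gt0.
have pos t : 0 <= t < e -> [/\ cdom c (f t), `|ccoord c (f t)| <= t * L,
   `|ccoord c (f t) - t *: X| <= `|M| * t ^+ 2, t * L < rho &
   t * L < r /\ 2 * C * (t * L) <= 1].
  rewrite /e !lt_min => /and3P[t0 /andP[td t1] /andP[/andP[trho tr] tC]].
  have [|cf fX] := fM t; first by rewrite t0.
  have tM : M * t ^+ 2 <= `|M| * t ^+ 2 by rewrite ler_wpM2r ?exprn_ge0// ler_norm.
  split=> //.
  - rewrite -[ccoord c (f t)](subrK (t *: X)); apply: (le_trans (ler_normD _ _)).
    rewrite normrZ (ger0_norm t0) /L.
    have : `|M| * t ^+ 2 <= `|M| * t.
      by rewrite ler_wpM2l// expr2 ler_piMl// ltW.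
    nra.
  - exact: le_trans fX tM.
  - by rewrite -ltr_pdivlMr.
  - split; first by rewrite -ltr_pdivlMr.
    have : t * (2 * C * L + 1) <= 1 by rewrite -ler_pdivlMr// div1r ltW.
    nra.
have both t : `|t| < e -> cdom c (f t) /\ `|ccoord c (f t) - t *: X| <= N * t ^+ 2.
  have [t0 te|t0 te] := leP 0 t.
    have [|cf _ fX _ _] := pos t; first by rewrite t0 -(ger0_norm t0).
    split=> //; apply: (le_trans fX).
    by rewrite ler_wpM2r ?exprn_ge0// /N lerDr !mulr_ge0// ?exprn_ge0// ltW.
  set s := - t; have s0 : 0 <= s by rewrite oppr_ge0 ltW.
  have se : s < e by rewrite /s -(ltr0_norm t0).
  have [|cf fL fX srho [sr sC]] := pos s; first by rewrite s0.
  have ft : f t = (f s)^-1%g by rewrite -hom_opp// opprK.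
  have [cft ftr] : cball c r (f t).
    by rewrite ft; apply: inv_rho; split=> //; exact: le_lt_trans srho.
  split=> //.
  have bs : cball c r (f s) by split=> //; exact: le_lt_trans sr.
  have m := mul_diff c1.2 r0 K (conj cft ftr) bs.
  rewrite {1}ft mulVg ccoord1 sub0r normrN in m.
  set P := ccoord c (f t) in m *; set Q := ccoord c (f s) in fX fL m.
  have Q0 := normr_ge0 Q; have P0 := normr_ge0 P.
  have PQ : `|P + Q| <= `|P| * (C * (s * L)).
    apply: (le_trans m); rewrite mulrAC mulrC ler_wpM2l//.
    by rewrite ler_wpM2l.
  have P2 : `|P| <= 2 * (s * L).
    have : `|P| <= `|P + Q| + `|Q|.
      by rewrite -{1}[P](addrK Q) (le_trans (ler_normB _ _)).
    nra.
  have -> : P - t *: X = (P + Q) - (Q - s *: X).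
    by rewrite addrKA opprK /s scaleNr.
  apply: (le_trans (ler_normB _ _)).
  have -> : t ^+ 2 = s ^+ 2 by rewrite sqrrN.
  have CsL : 0 <= C * (s * L) by rewrite !mulr_ge0// ltW.
  rewrite /N mulrDl lerD//; apply: (le_trans PQ).
  have -> : 2 * C * L ^+ 2 * s ^+ 2 = 2 * (s * L) * (C * (s * L)) by ring.
  by rewrite ler_wpM2r.
have fder : is_derive (0 : R) 1 (cfun c \o f) X.
  apply: (@is_derive0_quadratic _ _ _ _ N _ e0) => t te /=.
  by have [_ +] := both t te; rewrite hom_at0.
split=> //.
have f0 : f @ 0 --> (1 : G)%g.
  move=> W W1; have [q q0 qW] := cball_nbhs1 c1 W1.
  have : cfun c \o f @ (0 : R) --> cfun c 1%g.
    rewrite -(hom_at0 fD).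
    apply: (@differentiable_continuous _ _ _ (0 : R) (cfun c \o f)).
    by apply/derivable1_diffP; case: fder.
  move=> /cvgr_distC_lt /(_ q q0) fq.
  change (\forall t \near (0 : R), W (f t)); near=> t; apply: qW; split.
    by case: (both t) => //; near: t; exact: nbhs0_lt.
  by near: t.
move=> t.
have ft : (f t * f (s - t))%g @[s --> t] --> (f t * 1)%g.
  apply: mulg_cvg; first exact: cvg_cst.
  apply: (@cvg_comp _ _ _ (fun s => s - t) f _ (nbhs (0 : R))); last exact: f0.
  by apply/subr_cvg0; exact: cvg_id.
rewrite /continuous_at -[X in _ --> X]mulg1.
apply: cvg_trans ft; apply: near_eq_cvg; apply: nearW => s /=.
by rewrite -fD subrKC.
Unshelve. all: by end_near. Qed.

End one_parameter_subgroups.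
Section limits_of_powers.
Context {R : realType} {n : nat} {G : lieGroupType R n}.
Hypothesis G_compact : compact [set: G].
Variables (c : chart R n G) (c1 : chart_at1 c).

Definition subgroup_set (A : set G) : Prop :=
  A 1%g /\ (forall x y, A x -> A y -> A (x * y^-1)%g).

Lemma subgroup_setV A x : subgroup_set A -> A x -> A x^-1%g.
Proof. by move=> [A1 AV] Ax; rewrite -[x^-1%g]mul1g; exact: AV. Qed.

Lemma subgroup_setM A x y : subgroup_set A -> A x -> A y -> A (x * y)%g.
Proof.
by move=> sA Ax Ay; rewrite -[y]invgK; apply: sA.2 => //; exact: subgroup_setV.
Qed.

Lemma subgroup_zpow A x z : subgroup_set A -> A x -> A (zpow x z).
Proof.
move=> sA Ax; have AX k : A (x ^+ k)%g.
  elim: k => [|k IHk]; first by rewrite expg0; exact: sA.1.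
  by rewrite expgS; exact: subgroup_setM.
by case: z => k //=; exact: subgroup_setV.
Qed.

(** Keeps limits of points of a small ball inside the domain of the chart. *)
Lemma cball_closure : exists2 rho, 0 < rho & closure (cball c rho) `<=` cdom c.
Proof.
have reg : {for (1 : G)%g, regular_space G}.
  by apply: (compact_regular lie_hausdorff G_compact); exact: filterT.
have [N N1 Nc] := reg _ (nbhs_cdom c1.1 c1.2).
have [rho rho0 rN] := cball_nbhs1 c1 N1.
by exists rho => //; apply: subset_trans Nc; exact: closure_subset.
Qed.

Variables (A : set G) (F : set_system nat) (a : nat -> G) (e : nat -> R).
Variable X : 'rV[R]_n.
Hypotheses (A_closed : closed A) (A_subgroup : subgroup_set A).
Hypotheses (F_ultra : UltraFilter F) (Aa : forall k, A (a k)).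
Hypotheses (cdom_a : forall k, cdom c (a k)) (e_gt0 : forall k, 0 < e k).
Hypotheses (e_cvg0 : e @ F --> 0).
Hypothesis a_velocity : (e k)^-1 *: ccoord c (a k) @[k --> F] --> X.

(** The element a k, viewed as the value at time e k of the curve under
    construction, determines the value at time t up to one factor a k. *)
Let power k t : G := zpow (a k) (Num.floor (t / e k)).

Let F_proper : ProperFilter F := @ultra_proper _ _ F_ultra.
#[local] Existing Instance F_proper.

(** An ultrafilter on a compact space converges, so the limit is available for
    every t at once, without extracting a subsequence for each t. *)
Let pointwise_limit : {f : R -> G | forall t, power k t @[k --> F] --> f t}.
Proof.
have H t : exists x : G, power k t @[k --> F] --> x.
  have := G_compact; rewrite compact_ultra.
  move=> /(_ _ (@ultra_fmap _ _ _ (power^~ t) F_ultra)) [|x [_ Fx]].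
    exact: filterT.
  by exists x.
by have [f fP] := choice H; exists f.
Qed.

Let ccoord_a_cvg0 : ccoord c (a k) @[k --> F] --> (0 : 'rV[R]_n).
Proof.
have -> : (fun k => ccoord c (a k)) =
    (fun k => e k *: ((e k)^-1 *: ccoord c (a k))).
  by apply/funext => k; rewrite scalerA mulfV ?gt_eqF// scale1r.
by rewrite -(scale0r X); exact: cvgZ.
Qed.

Let a_cvg1 : a @ F --> (1 : G)%g.
Proof.
move=> W W1; have [q q0 qW] := cball_nbhs1 c1 W1.
move: (ccoord_a_cvg0) => /cvgr0_norm_lt /(_ _ q0) aq.
apply: (@filterS _ F _ (fun k => `|ccoord c (a k)| < q)) aq => k akq.
by apply: qW; split.
Qed.

Lemma floorD_bool (x y : R) : exists b : bool,
  Num.floor (x + y) = Num.floor x + Num.floor y + b%:Z.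
Proof.
have /andP[x1 x2] := floor_itv x; have /andP[y1 y2] := floor_itv y.
have [xy|xy] := ltP (x + y) ((Num.floor x + Num.floor y + 1)%:~R).
  exists false; rewrite addr0; apply: floor_def; rewrite xy andbT.
  by rewrite intrD lerD.
exists true; apply: floor_def; rewrite xy /= -addrA.
move: x2 y2; rewrite !intrD; lra.
Qed.

(** Rounding changes the exponent by at most 1, and a k tends to 1. *)
Let limit_hom (f : R -> G) : (forall t, power k t @[k --> F] --> f t) ->
  forall s t, f (s + t) = (f s * f t)%g.
Proof.
move=> fP s t; apply: (cvg_unique lie_hausdorff (fP (s + t))).
have /choice[b bP] : forall k, exists b : bool,
    power k (s + t) = (power k s * power k t * zpow (a k) b)%g.
  move=> k; have [b bE] := floorD_bool (s / e k) (t / e k).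
  by exists b; rewrite /power mulrDl bE !zpowD.
have zb : zpow (a k) (b k) @[k --> F] --> (1 : G)%g.
  move=> W W1; have aW : F [set k | W (a k)] by exact: a_cvg1.
  apply: (@filterS _ F _ _ _ _ aW) => k /= Wak.
  by case: (b k); rewrite /= ?expg1 ?expg0//; exact: nbhs_singleton.
have -> : power^~ (s + t) =
    (fun k => (power k s * power k t * zpow (a k) (b k))%g) by exact/funext.
have H := mulg_cvg (mulg_cvg (fP s) (fP t)) zb; rewrite mulg1 in H.
exact: H.
Qed.

(** With j the rounded quotient t / e k, the coordinate of the j-th power of a k
    is j times that of a k up to a quadratic error, and the latter tends to
    t X. *)
Let limit_estimate (f : R -> G) : (forall t, power k t @[k --> F] --> f t) ->
  exists M d : R, 0 < d /\ forall t, 0 <= t < d ->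
    cdom c (f t) /\ `|ccoord c (f t) - t *: X| <= M * t ^+ 2.
Proof.
move=> fP; have [C [r [C0 r0 K]]] := mul_second_difference c1.
have [rho rho0 rhoc] := cball_closure.
have rr0 : 0 < Num.min r rho by rewrite lt_min r0.
have [d [d0 drr dC]] := exists_pow_radius C0 rr0.
have [dr drho] : 4 * d <= r /\ 4 * d <= rho.
  by split; apply: (le_trans drr); rewrite ge_min lexx ?orbT.
have X1 : 0 < `|X| + 1 by rewrite ltr_pwDr.
exists (C * `|X| ^+ 2), (d / (`|X| + 1)); split; first by rewrite divr_gt0.
move=> t /andP[t0]; rewrite ltr_pdivlMr// => tX.
pose j k := `|Num.floor (t / e k)|%N.
pose q k := (e k)^-1 *: ccoord c (a k).
have te0 k : 0 <= t / e k by rewrite divr_ge0// ltW.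
have jE k : Num.floor (t / e k) = j k by rewrite /j gez0_abs// floor_ge0.
have jt : (j k)%:R * e k @[k --> F] --> t.
  apply: (@squeeze_cvgr _ _ _ _ (fun k => t - e k) (fun=> t)).
  - apply: nearW => k; have := floor_itv (t / e k); rewrite jE => /andP[j1 j2].
    move: j1; rewrite ler_pdivlMr// => ->; rewrite andbT.
    by move: j2; rewrite ltr_pdivrMr// intrD mulrDl mul1r -ltrBlDr => /ltW.
  - by rewrite -[X in _ --> X]subr0; apply: cvgB => //; exact: cvg_cst.
  - exact: cvg_cst.
have jp k : (j k)%:R *: ccoord c (a k) = ((j k)%:R * e k) *: q k.
  by rewrite /q scalerA mulfK// gt_eqF.
have jnp k : (j k)%:R * `|ccoord c (a k)| = (j k)%:R * e k * `|q k|.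
  have ek0 := e_gt0 k.
  by rewrite /q normrZ gtr0_norm ?invr_gt0// mulrA mulfK// gt_eqF.
have cvg1 : (j k)%:R *: ccoord c (a k) @[k --> F] --> t *: X.
  by under eq_fun do rewrite jp; exact: cvgZ.
have cvg2 : (j k)%:R * `|ccoord c (a k)| @[k --> F] --> t * `|X|.
  by under eq_fun do rewrite jnp; apply: cvgM => //; exact: cvg_norm.
have near_d : \forall k \near F, (j k)%:R * `|ccoord c (a k)| <= d.
  by move: cvg2 => /cvgr_le; apply; lra.
have powerE k : power k t = (a k ^+ j k)%g by rewrite /power jE.
have pe := pow_estimate c1.2 C0 r0 K dr dC.
have cft : cdom c (f t).
  apply: rhoc.
  apply: (@closed_cvg _ _ F _ (power^~ t) (closure (cball c rho))) (fP t).
    exact: closed_closure.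
  apply: (@filterS _ F _ _ _ _ near_d) => k kd.
  apply: subset_closure; rewrite powerE.
  have [[cp _] pd _] := pe _ _ (cdom_a k) kd.
  by split=> //; apply: (le_lt_trans pd); lra.
split=> //.
have lcvg : `|ccoord c (power k t) - (j k)%:R *: ccoord c (a k)| @[k --> F] -->
    `|ccoord c (f t) - t *: X|.
  apply: cvg_norm; apply: cvgB => //.
  exact: (cvg_comp _ _ (fP t) (ccoord_continuous c1.1 cft)).
have rcvg : C * ((j k)%:R * `|ccoord c (a k)|) ^+ 2 @[k --> F] -->
    C * (t * `|X|) ^+ 2.
  by apply: cvgM; [exact: cvg_cst|apply: cvgM].
have -> : C * `|X| ^+ 2 * t ^+ 2 = C * (t * `|X|) ^+ 2 by ring.
apply: (ler_cvg_to lcvg rcvg); apply: (@filterS _ F _ _ _ _ near_d) => k kd.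
by rewrite powerE; have [] := pe _ _ (cdom_a k) kd.
Qed.

(** If elements a k of a closed subgroup A tend to 1 in the direction X, then X
    is the velocity of a one-parameter subgroup of A. This is the step by which
    a closed subgroup is seen to have tangent vectors, and with A the whole
    group it provides the exponential map. *)
Lemma one_parameter_limit : exists f : R -> G,
  [/\ one_param f, (forall t, A (f t)) & is_derive (0 : R) 1 (cfun c \o f) X].
Proof.
have [f fP] := pointwise_limit.
have fD := limit_hom fP.
have [M [d [d0 fM]]] := limit_estimate fP.
have [fc fX] := hom_velocity c1 fD d0 fM.
exists f; split=> // t.
apply: (@closed_cvg _ _ F _ (power^~ t) A A_closed) (fP t).
apply: (@filterE _ F) => k.
exact: subgroup_zpow.
Qed.

End limits_of_powers.
(** * Existence and uniqueness of one-parameter subgroups *)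

Section exponential.
Context {R : realType} {n : nat} {G : lieGroupType R n}.
Variables (c : chart R n G) (c1 : chart_at1 c).
Implicit Types (f p : R -> G) (X : 'rV[R]_n).

Definition velocity f X := is_derive (0 : R) 1 (cfun c \o f) X.

Lemma velocity_unique f X Y : velocity f X -> velocity f Y -> X = Y.
Proof. by move=> [_ <-] [_ <-]. Qed.

Lemma velocity_ccoord f X : f 0 = 1%g -> velocity f X ->
  h^-1 *: ccoord c (f h) @[h --> (0 : R)^'] --> X.
Proof.
by move=> f0 /is_derive0P; apply: cvg_trans; rewrite /comp f0.
Qed.

Lemma near_cdom f : {for (0 : R), continuous f} -> f 0 = 1%g ->
  \forall t \near (0 : R), cdom c (f t).
Proof.
by move=> fc f0; apply: fc; rewrite f0; exact: nbhs_cdom c1.1 c1.2.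
Qed.

Lemma one_parameter_exists X : compact [set: G] ->
  exists f, one_param f /\ velocity f X.
Proof.
move=> G_compact.
have /nbhs_ballP [eps /= eps0 epsc] := nbhs_cimg c1.1 c1.2.
have [F [F_ultra ooF]] := @ultraFilterLemma nat \oo _.
(* The times e k = s / (k + 1) keep o + e k X in the image of the chart. *)
pose s := eps / (`|X| + 1); have X1 : 0 < `|X| + 1 by rewrite ltr_pwDr.
have s0 : 0 < s by rewrite divr_gt0.
pose e (k : nat) : R := s * k.+1%:R^-1.
have e0 k : 0 < e k by rewrite mulr_gt0.
have es k : e k <= s by rewrite ger_pMr// invf_le1// ler1n.
have aP k : exists x, cdom c x /\ ccoord c x = e k *: X.
  have [x cx xE] : cimg c (cfun c 1%g + e k *: X).
    apply: epsc; rewrite -ball_normE /= opprD addrA subrr sub0r normrN normrZ.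
    rewrite gtr0_norm//; apply: (@le_lt_trans _ _ (s * `|X|)).
      by rewrite ler_wpM2r.
    by rewrite /s mulrAC ltr_pdivrMr// ltr_pM2l// ltrDl.
  by exists x; split=> //; rewrite /ccoord xE addrAC subrr add0r.
have [a aE] := choice aP.
have FF : ProperFilter F := @ultra_proper _ _ F_ultra.
have e_cvg : e @ F --> 0.
  have e_oo : e @ \oo --> (0 : R).
    rewrite -(mulr0 s).
    exact: (cvgM (cvg_cst s) (@cvg_harmonic R)).
  by move=> W /e_oo; exact: ooF.
have a_cvg : (e k)^-1 *: ccoord c (a k) @[k --> F] --> X.
  have -> : (fun k => (e k)^-1 *: ccoord c (a k)) = (fun=> X).
    by apply/funext => k; rewrite (aE k).2 scalerK// gt_eqF.
  exact: cvg_cst.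
have [||||f [fD _ fX]] := one_parameter_limit G_compact c1 (A := setT)
  (F := F) (a := a) (e := e) (X := X) _ _ F_ultra _ _ e0 e_cvg a_cvg.
- exact: closedT.
- by [].
- by [].
- by move=> k; have [] := aE k.
by exists f.
Qed.

Lemma hom_natmul f s j : (forall s t, f (s + t) = (f s * f t)%g) ->
  f (j%:R * s) = (f s ^+ j)%g.
Proof.
move=> fD; elim: j => [|j IHj]; first by rewrite mul0r hom_at0.
by rewrite -natr1 mulrDl mul1r fD IHj expgSr.
Qed.

Lemma near0_divn (P : set R) t : 0 < t -> (\forall s \near (0 : R)^', P s) ->
  exists j : nat, [/\ 0 < j%:R :> R & P (t / j%:R)].
Proof.
move=> t0 [del /= del0 delP]; exists (Num.truncn (t / del)).+1.
have j0 : 0 < (Num.truncn (t / del)).+1%:R :> R by rewrite ltr0n.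
split=> //; apply: delP; last by rewrite gt_eqF// divr_gt0.
rewrite /= sub0r normrN gtr0_norm ?divr_gt0// ltr_pdivrMr// mulrC.
by rewrite -ltr_pdivrMr// truncnS_gt.
Qed.

(** Write f t and p t as j-th powers of f (t / j) and p (t / j): these differ by
    o(1 / j), so the powers differ by o(1). *)
Lemma one_parameter_unique f p X : one_param f -> one_param p ->
  velocity f X -> velocity p X -> f = p.
Proof.
move=> [fD fc] [pD pc] fX pX; have [C [r [C0 r0 K]]] := mul_second_difference c1.
have f0 := hom_at0 fD; have p0 := hom_at0 pD.
have [d [d0 dr dC]] := exists_pow_radius C0 r0.
have X1 : 0 < `|X| + 1 by rewrite ltr_pwDr.
have fv := velocity_ccoord f0 fX; have pv := velocity_ccoord p0 pX.
have small t : 0 < t -> t * (`|X| + 1) <= d -> f t = p t.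
  move=> t0 td.
  have key eps : 0 < eps -> [/\ cdom c (f t), cdom c (p t) &
      `|ccoord c (f t) - ccoord c (p t)| <= eps].
    move=> eps0; pose del := eps / (4 * t).
    have del0 : 0 < del by rewrite divr_gt0// mulr_gt0.
    have nX (q : R -> G) : h^-1 *: ccoord c (q h) @[h --> (0 : R)^'] --> X ->
        \forall s \near (0 : R)^', `|s^-1 *: ccoord c (q s)| <= `|X| + 1.
      move=> qv.
      have : `|h^-1 *: ccoord c (q h)| @[h --> (0 : R)^'] --> `|X|.
        exact: cvg_norm.
      by move=> /cvgr_le; apply; rewrite ltrDl.
    have [j [j0 [[[[cf cp] [fs ps]] fj] pj]]] := near0_divn t0
      (filterI (filterI (filterI
        (filterI (nbhs_dnbhs (near_cdom (fc 0) f0))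
          (nbhs_dnbhs (near_cdom (pc 0) p0)))
        (filterI (nX f fv) (nX p pv)))
        ((cvgrPdist_le _ _).1 fv _ del0)) ((cvgrPdist_le _ _).1 pv _ del0)).
    move: cf cp fs ps fj pj; set s := t / j%:R => /= cf cp fs ps fj pj.
    have s0 : 0 < s by rewrite divr_gt0.
    have ts : t = j%:R * s by rewrite /s mulrC divfK// gt_eqF.
    have bnd (q : R -> G) : `|s^-1 *: ccoord c (q s)| <= `|X| + 1 ->
        j%:R * `|ccoord c (q s)| <= d.
      rewrite normrZ normfV (gtr0_norm s0) mulrC ler_pdivrMr// => qs.
      apply: le_trans td; rewrite ts -mulrA ler_wpM2l//.
      by rewrite mulrC.
    have := pow_diff_estimate c1.2 C0 r0 K dr dC cf cp (bnd f fs) (bnd p ps).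
    have [[cft _] _ _] := pow_estimate c1.2 C0 r0 K dr dC cf (bnd f fs).
    have [[cpt _] _ _] := pow_estimate c1.2 C0 r0 K dr dC cp (bnd p ps).
    have ftE : (f s ^+ j)%g = f t by rewrite ts hom_natmul.
    have ptE : (p s ^+ j)%g = p t by rewrite ts hom_natmul.
    rewrite ftE ptE in cft cpt * => H; split=> //; apply: (le_trans H).
    have -> : ccoord c (f s) - ccoord c (p s) =
        s *: ((X - s^-1 *: ccoord c (p s)) - (X - s^-1 *: ccoord c (f s))).
      have -> (x y z : 'rV[R]_n) : (x - z) - (x - y) = y - z.
        by rewrite opprB addrC subrKA.
      by rewrite -scalerBr scalerA mulfV ?gt_eqF// scale1r.
    rewrite normrZ (gtr0_norm s0) [j%:R * (s * _)]mulrA -ts.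
    have : `|(X - s^-1 *: ccoord c (p s)) - (X - s^-1 *: ccoord c (f s))|
        <= 2 * del.
      by rewrite (le_trans (ler_normB _ _))// mulr2n mulrDl mul1r lerD.
    have : 4 * t * del = eps by rewrite /del mulrC divfK// gt_eqF// mulr_gt0.
    nra.
  have [cft cpt _] := key 1 ltr01.
  apply: (ccoord_inj c1.1 cft cpt); apply/eqP; rewrite -subr_eq0 -normr_le0.
  by apply/ler_addgt0Pl => eps eps0; rewrite addr0; have [] := key eps eps0.
have pos t : 0 < t -> f t = p t.
  move=> t0; have [|j [j0 jt]] := @near0_divn [set s | `|s| <= d / (`|X| + 1)] t t0.
    by apply: dnbhs0_le; rewrite divr_gt0.
  have s0 : 0 < t / j%:R by rewrite divr_gt0.
  have ts : t = j%:R * (t / j%:R) by rewrite mulrC divfK// gt_eqF.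
  rewrite ts !hom_natmul//; congr (_ ^+ _)%g; apply: small => //.
  by rewrite -ler_pdivlMr//; move: jt => /=; rewrite gtr0_norm.
apply/funext => t; have [t0|t0|<-] := ltgtP 0 t; [exact: pos| |by rewrite f0 p0].
rewrite -[t]opprK (hom_opp _ fD) (hom_opp _ pD); congr (_^-1)%g.
by apply: pos; rewrite oppr_gt0.
Qed.

End exponential.

(** * The adjoint representation *)

Section adjoint_representation.
Context {R : realType} {n : nat} {G : lieGroupType R n}.
Variables (c : chart R n G) (c1 : chart_at1 c).
Local Notation V := 'rV[R]_n.
Local Notation o := (cfun c 1%g).
Implicit Types (a b : chart R n G) (g h : G) (f : R -> G) (X Y : V).

Lemma cinv_at1 : cinv c o = 1%g. Proof. exact: atlas_cinvK c1.1 c1.2. Qed.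

Lemma cinv_cvg1 : cinv c u @[u --> o] --> (1 : G)%g.
Proof.
rewrite -[X in _ --> X]cinv_at1; exact: (atlas_cinv_continuous c1.1 c1.2).
Qed.

Lemma mulg_cinv_cvg g : (g * cinv c u)%g @[u --> o] --> g.
Proof.
have FF : ProperFilter (nbhs o) by exact: nbhs_pfilter.
have := mulg_cvg (cvg_cst g) cinv_cvg1; rewrite mulg1; exact.
Qed.

Lemma mul_chart_differentiable (d a b : chart R n G) x y :
  atlas d -> atlas a -> atlas b -> cdom d x -> cdom a y -> cdom b (x * y)%g ->
  differentiable (fun p : V * V => cfun b (cinv d p.1 * cinv a p.2)%g)
    (cfun d x, cfun a y).
Proof.
move=> dA aA bA dx ay bxy.
have [H _] := @mulg_smooth _ _ G d a b dA aA bA 1; apply: H; split.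
- by exists x.
- by exists y.
- by rewrite /= !atlas_cinvK.
Qed.

(** Conjugation is left translation by g into a chart around g, followed by
    right translation by the inverse of g back into c. *)
Lemma Ad_differentiable g :
  differentiable (fun u => cfun c (g * cinv c u * g^-1)%g) o.
Proof.
have [a aA ag] := atlas_cover g.
have [b bA bg] := atlas_cover g^-1%g.
pose L u := cfun a (g * cinv c u)%g.
pose Rt v := cfun c (cinv a v * g^-1)%g.
have oL : L o = cfun a g by rewrite /L cinv_at1 mulg1.
have dL : differentiable L o.
  have /= := @differentiable_comp _ _ _ _ (fun u : V => (cfun a g, u)) _ o
    (differentiable_pairr (cfun a g) o)
    (@mul_chart_differentiable a c a g 1%g aA c1.1 aA ag c1.2 _).
  rewrite mulg1 => /(_ ag); congr (differentiable _ _).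
  by apply/funext => u /=; rewrite /L atlas_cinvK.
have dR : differentiable Rt (L o).
  have /= := @differentiable_comp _ _ _ _ (fun u : V => (u, cfun b g^-1%g)) _ (L o)
    (differentiable_pairl (L o) (cfun b g^-1%g)).
  move=> /(_ _ (fun p : V * V => cfun c (cinv a p.1 * cinv b p.2)%g)).
  rewrite oL => /(_ (@mul_chart_differentiable a b c g g^-1%g aA bA c1.1 ag bg _)).
  rewrite mulgV => /(_ c1.2); congr (differentiable _ _).
  by apply/funext => u /=; rewrite /Rt atlas_cinvK.
apply: near_eq_differentiable (differentiable_comp dL dR).
have : \forall u \near o, cdom a (g * cinv c u)%g.
  exact: (mulg_cinv_cvg (nbhs_cdom aA ag)).
by apply: filterS => u agu; rewrite /Rt /L /= atlas_cinvK.
Qed.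

Lemma near_cinvK f : {for (0 : R), continuous f} -> f 0 = 1%g ->
  \forall t \near (0 : R), cinv c (cfun c (f t)) = f t.
Proof.
by move=> fc f0; apply: filterS (near_cdom c1 fc f0) => t; exact: atlas_cinvK c1.1.
Qed.

Lemma velocity_Ad g f X : {for (0 : R), continuous f} -> f 0 = 1%g ->
  velocity c f X -> velocity c (fun t => g * f t * g^-1)%g (Ad c g X).
Proof.
move=> fc f0 fX.
have dA : differentiable (fun u => cfun c (g * cinv c u * g^-1)%g)
    ((cfun c \o f) 0).
  by rewrite /= f0; exact: Ad_differentiable.
have := is_derive_comp_diff fX dA; rewrite /= f0.
apply: near_eq_is_derive.
by apply: filterS (near_cinvK fc f0) => t /= ->.
Qed.

Lemma AdD g X Y : Ad c g (X + Y) = Ad c g X + Ad c g Y.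
Proof. exact: linearD. Qed.

Lemma AdZ g (k : R) X : Ad c g (k *: X) = k *: Ad c g X.
Proof. exact: linearZ. Qed.

(** Near the identity, conjugation is v |-> mu (mu (u, v), io u), where mu and io
    are the multiplication and the inverse in coordinates. Its derivative at the
    identity is a combination of first partial derivatives of mu at points
    depending smoothly on u, with coefficients w u depending smoothly on u. *)
Lemma Ad_cinv_differentiable Y : differentiable (fun u => Ad c (cinv c u) Y) o.
Proof.
pose mu (p : V * V) := cfun c (cinv c p.1 * cinv c p.2)%g.
pose io u := cfun c (cinv c u)^-1%g.
pose U := [set p : V * V |
  [/\ cimg c p.1, cimg c p.2 & cdom c (cinv c p.1 * cinv c p.2)%g]].
have [dmu ddmu] : Ck 2 U mu := @mulg_smooth _ _ G c c c c1.1 c1.1 c1.1 2.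
pose w u := 'D_(0, Y) mu (u, o).
have cimgo : cimg c o by exists 1%g => //; exact: c1.2.
have Uo : U (o, o) by split=> //=; rewrite cinv_at1 mulg1; exact: c1.2.
have io_o : io o = o by rewrite /io cinv_at1 invg1.
have dio : differentiable io o.
  have [H _] := @invg_smooth _ _ G c c c1.1 c1.1 1; apply: H.
  by split=> //; rewrite cinv_at1 invg1; exact: c1.2.
have dw : differentiable w o.
  apply: (@differentiable_comp _ _ _ _ (fun u : V => (u, o)) ('D_(0, Y) mu)).
    exact: differentiable_pairl.
  exact: (ddmu (0, Y)).1.
have di := @ex_diff _ _ _ _ _ _ _ (is_diff_id o).
have dE (v : V) : differentiable (fun u => 'D_(v, 0) mu (u, io u)) o.
  apply: (@differentiable_comp _ _ _ _ (fun u : V => (u, io u)) ('D_(v, 0) mu)).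
    exact: (differentiable_pair di dio).
  by rewrite io_o; exact: (ddmu (v, 0)).1.
pose F := \sum_(i < n) (fun u => w u 0 i *: 'D_(delta_mx 0 i, 0) mu (u, io u)).
have dF : differentiable F o.
  apply: differentiable_sum => i.
  have dwi : differentiable (fun u => w u 0 i : R) o.
    exact: (@differentiable_comp _ _ _ _ w (fun v : 'rV[R]_n => v 0 i) o dw
      (differentiable_coord _ _ _)).
  exact: (differentiable_scale dwi (dE _)).
apply: near_eq_differentiable dF.
have nU : \forall u \near o, cimg c u by exact: nbhs_cimg c1.1 c1.2.
have ni : \forall u \near o, cdom c (cinv c u)^-1%g.
  have FF : ProperFilter (nbhs o) by exact: nbhs_pfilter.
  have H := invg_cvg cinv_cvg1; rewrite invg1 in H.
  exact: (H _ _ (nbhs_cdom c1.1 c1.2)).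
apply: filterS (filterI nU ni) => u [[x cx <-{u}]].
rewrite (atlas_cinvK c1.1 cx) => cxV.
have Uxo : U (cfun c x, o).
  by split=> //=; [exists x|rewrite cinv_at1 (atlas_cinvK c1.1 cx) mulg1].
have Uxi : U (cfun c x, io (cfun c x)).
  split=> /=; first by exists x.
    by exists x^-1%g; rewrite // /io (atlas_cinvK c1.1 cx).
  by rewrite /io (atlas_cinvK c1.1 cx) (atlas_cinvK c1.1 cxV) mulgV; exact: c1.2.
rewrite /Ad -deriveE; last exact: Ad_differentiable.
have E : \forall v \near o, mu (mu (cfun c x, v), io (cfun c x)) =
    cfun c (cinv c (cfun c x) * cinv c v * (cinv c (cfun c x))^-1)%g.
  have nx : \forall v \near o, cdom c (x * cinv c v)%g.
    exact: (mulg_cinv_cvg (nbhs_cdom c1.1 cx)).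
  apply: filterS nx => v cxv.
  rewrite /mu /io /= !(atlas_cinvK c1.1 cx).
  by rewrite (atlas_cinvK c1.1 cxV) (atlas_cinvK c1.1 cxv).
rewrite (atlas_cinvK c1.1 cx) in E.
rewrite -(near_eq_derive _ E).
have mux : mu (cfun c x, o) = cfun c x.
  by rewrite /mu /= cinv_at1 mulg1 (atlas_cinvK c1.1 cx).
have dmu2 : differentiable (fun v => mu (cfun c x, v)) o.
  apply: (@differentiable_comp _ _ _ _ (fun v : V => (cfun c x, v)) mu).
    exact: differentiable_pairr.
  exact: dmu.
have dmu1 : differentiable (fun v => mu (v, io (cfun c x))) (mu (cfun c x, o)).
  apply: (@differentiable_comp _ _ _ _ (fun v : V => (v, io (cfun c x))) mu).
    exact: differentiable_pairl.
  by rewrite mux; exact: dmu.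
rewrite deriveE; last exact: differentiable_comp dmu2 dmu1.
rewrite (diff_comp dmu2 dmu1) /= -deriveE// -deriveE//.
rewrite (derive_pairl mu) (derive_pairr mu) mux -/(w (cfun c x)).
rewrite deriveE; last exact: dmu.
rewrite row_sum_pair0 linear_sum /F fct_sumE; apply: eq_bigr => i _.
by rewrite linearZ /= -deriveE//; exact: dmu.
Qed.

Lemma is_derive_Ad f X Y : {for (0 : R), continuous f} -> f 0 = 1%g ->
  velocity c f X ->
  is_derive (0 : R) 1 (fun t => Ad c (f t) Y) (lie_bracket c X Y).
Proof.
move=> fc f0 fX.
have dA : differentiable (fun u => Ad c (cinv c u) Y) ((cfun c \o f) 0).
  by rewrite /= f0; exact: Ad_cinv_differentiable.
have := is_derive_comp_diff fX dA; rewrite /= f0.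
apply: near_eq_is_derive.
by apply: filterS (near_cinvK fc f0) => t /= ->.
Qed.

End adjoint_representation.
(** * The Lie algebra *)

Section bilinear_curves.
Context {R : realType} {W : normedModType R} {n : nat}.
Local Notation V := 'rV[R]_n.

Lemma cvg_coord (I : Type) (F : set_system I) {FF : Filter F} (u : I -> V)
    (v : V) i :
  u @ F --> v -> u k 0 i @[k --> F] --> v 0 i.
Proof. by move=> uv; exact: (cvg_comp _ _ uv (@coord_continuous _ _ _ 0 i v)). Qed.

Lemma linear_cvg (L : V -> W) (I : Type) (F : set_system I) {FF : Filter F}
    (u : I -> V) (v : V) :
  (forall x y, L (x + y) = L x + L y) -> (forall k x, L (k *: x) = k *: L x) ->
  u @ F --> v -> L (u k) @[k --> F] --> L v.
Proof.
move=> LD LZ uv.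
have LE x : L x = \sum_i x 0 i *: L (delta_mx 0 i).
  have L0 : L 0 = 0 by rewrite -(scale0r 0) LZ scale0r.
  rewrite [in LHS](row_sum_delta x) (big_morph L LD L0).
  by apply: eq_bigr => i _; rewrite LZ.
rewrite (_ : (fun k => L (u k)) =
  (fun k => \sum_i u k 0 i *: L (delta_mx 0 i))); last exact/funext.
rewrite LE; apply: cvg_big => [|i _]; first exact: add_continuous.
by apply: cvgZr_tmp; exact: cvg_coord.
Qed.

Variable B : V -> V -> W.
Hypotheses (BDl : forall x y z, B (x + y) z = B x z + B y z)
  (BZl : forall k x y, B (k *: x) y = k *: B x y)
  (BDr : forall x y z, B x (y + z) = B x y + B x z)
  (BZr : forall k x y, B x (k *: y) = k *: B x y).

Lemma bilinear_cvg (I : Type) (F : set_system I) {FF : Filter F}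
    (u v : I -> V) (x y : V) :
  u @ F --> x -> v @ F --> y -> B (u k) (v k) @[k --> F] --> B x y.
Proof.
move=> ux vy.
have BE z w : B z w = \sum_i z 0 i *: B (delta_mx 0 i) w.
  have B0 : B 0 w = 0 by rewrite -(scale0r 0) BZl scale0r.
  rewrite [in LHS](row_sum_delta z).
  rewrite (big_morph (B^~ w) (fun a b => BDl a b w) B0).
  by apply: eq_bigr => i _; rewrite BZl.
rewrite (_ : (fun k => B (u k) (v k)) =
  (fun k => \sum_i u k 0 i *: B (delta_mx 0 i) (v k))); last exact/funext.
rewrite BE; apply: cvg_big => [|i _]; first exact: add_continuous.
by apply: cvgZ; [exact: cvg_coord|exact: linear_cvg].
Qed.

Lemma is_derive_bilinear (u v : R -> V) x y :
  is_derive (0 : R) 1 u x -> is_derive (0 : R) 1 v y ->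
  is_derive (0 : R) 1 (fun t => B (u t) (v t)) (B x (v 0) + B (u 0) y).
Proof.
move=> du dv; apply/is_derive0P.
have ux := iffLR (is_derive0P _ _) du; have vy := iffLR (is_derive0P _ _) dv.
have v0 : v t @[t --> (0 : R)^'] --> v 0.
  apply: cvg_within_filter; apply: (@differentiable_continuous _ _ _ (0 : R) v).
  by apply/derivable1_diffP; case: dv.
have BBr a b d : B a (b - d) = B a b - B a d by rewrite BDr -scaleN1r BZr scaleN1r.
have BBl a b d : B (a - b) d = B a d - B b d by rewrite BDl -scaleN1r BZl scaleN1r.
rewrite (_ : (fun h => _) = (fun h => B (h^-1 *: (u h - u 0)) (v h) +
  B (u 0) (h^-1 *: (v h - v 0)))); last first.
  apply/funext => h; rewrite BZl BZr BBl BBr -scalerDr; congr (_ *: _).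
  by rewrite subrKA.
by apply: cvgD; apply: bilinear_cvg => //; exact: cvg_cst.
Qed.

End bilinear_curves.

Lemma is_derive_linear {R : realType} {n : nat} {W : normedModType R}
    (L : 'rV[R]_n -> W) (u : R -> 'rV[R]_n) x :
  (forall x y, L (x + y) = L x + L y) -> (forall k x, L (k *: x) = k *: L x) ->
  is_derive (0 : R) 1 u x -> is_derive (0 : R) 1 (L \o u) (L x).
Proof.
move=> LD LZ du; apply/is_derive0P.
have ux := iffLR (is_derive0P _ _) du.
rewrite (_ : (fun h => _) = (fun h => L (h^-1 *: (u h - u 0)))).
  exact: linear_cvg.
by apply/funext => h /=; rewrite LZ LD -(scaleN1r (u 0)) LZ scaleN1r.
Qed.

Lemma is_derive_unique {R : realType} {W : normedModType R} (f : R -> W) X Y :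
  is_derive (0 : R) 1 f X -> is_derive (0 : R) 1 f Y -> X = Y.
Proof. by move=> [_ <-] [_ <-]. Qed.

Section lie_algebra.
Context {R : realType} {n : nat} {G : lieGroupType R n}.
Hypothesis G_compact : compact [set: G].
Variables (c : chart R n G) (c1 : chart_at1 c).
Local Notation V := 'rV[R]_n.
Local Notation br := (lie_bracket c).
Implicit Types (g h : G) (f : R -> G) (X Y Z : V).

Lemma conj_continuous0 g f : {for (0 : R), continuous f} -> f 0 = 1%g ->
  {for (0 : R), continuous (fun t => g * f t * g^-1)%g}.
Proof.
move=> fc f0; rewrite /prop_for /continuous_at.
by apply: mulg_cvg; [apply: mulg_cvg => //; exact: cvg_cst|exact: cvg_cst].
Qed.

Lemma AdM g h X : Ad c (g * h)%g X = Ad c g (Ad c h X).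
Proof.
have [f [[fD fc] fX]] := one_parameter_exists c1 X G_compact.
have f0 := hom_at0 fD.
have v1 := velocity_Ad c1 (g * h)%g (fc 0) f0 fX.
have h0 : (h * f 0 * h^-1)%g = 1%g by rewrite f0 mulg1 mulgV.
have v2 := velocity_Ad c1 g (conj_continuous0 (g := h) (fc 0) f0) h0
  (velocity_Ad c1 h (fc 0) f0 fX).
apply: velocity_unique v1 _; rewrite /velocity.
rewrite (_ : (fun t => g * h * f t * (g * h)^-1)%g =
  (fun t => g * (h * f t * h^-1) * g^-1)%g)//.
by apply/funext => t; rewrite invgM !mulgA.
Qed.

Lemma Ad1 X : Ad c 1%g X = X.
Proof.
have [f [[fD fc] fX]] := one_parameter_exists c1 X G_compact.
have := velocity_Ad c1 1%g (fc 0) (hom_at0 fD) fX.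
rewrite (_ : (fun t => _) = f); first by move=> H; exact: (velocity_unique H fX).
by apply/funext => t; rewrite mul1g invg1 mulg1.
Qed.

Lemma bracketDl X Y Z : br (X + Y) Z = (br X Z) + (br Y Z).
Proof. exact: linearD. Qed.

Lemma bracketZl (k : R) X Y : (br (k *: X) Y) = k *: (br X Y).
Proof. exact: linearZ. Qed.

Lemma bracketDr X Y Z : br X (Y + Z) = (br X Y) + (br X Z).
Proof.
have [f [[fD fc] fX]] := one_parameter_exists c1 X G_compact.
have f0 := hom_at0 fD.
apply: is_derive_unique (is_derive_Ad c1 (Y + Z) (fc 0) f0 fX) _.
rewrite (_ : (fun t => _) = (fun t => Ad c (f t) Y) + (fun t => Ad c (f t) Z)).
  by apply: is_deriveD; exact: (is_derive_Ad c1 _ (fc 0) f0 fX).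
by apply/funext => t; exact: AdD.
Qed.

Lemma bracketZr (k : R) X Y : (br X (k *: Y)) = k *: (br X Y).
Proof.
have [f [[fD fc] fX]] := one_parameter_exists c1 X G_compact.
have f0 := hom_at0 fD.
apply: is_derive_unique (is_derive_Ad c1 (k *: Y) (fc 0) f0 fX) _.
rewrite (_ : (fun t => _) = k \*: (fun t => Ad c (f t) Y)).
  by apply: is_deriveZ; exact: (is_derive_Ad c1 _ (fc 0) f0 fX).
by apply/funext => t; exact: AdZ.
Qed.

Lemma bracket_Ad_fixed f X Y : {for (0 : R), continuous f} -> f 0 = 1%g ->
  velocity c f X -> (\forall t \near (0 : R), Ad c (f t) Y = Y) -> (br X Y) = 0.
Proof.
move=> fc f0 fX fY; apply: is_derive_unique (is_derive_Ad c1 Y fc f0 fX) _.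
apply: near_eq_is_derive (is_derive_cst Y (0 : R) (1 : R)).
by apply: filterS fY => t ->.
Qed.

Lemma Ad_commute g f X : {for (0 : R), continuous f} -> f 0 = 1%g ->
  velocity c f X -> (forall t, (g * f t)%g = (f t * g)%g) -> Ad c g X = X.
Proof.
move=> fc f0 fX gf; have := velocity_Ad c1 g fc f0 fX.
rewrite (_ : (fun t => _) = f); first by move=> H; exact: (velocity_unique H fX).
by apply/funext => t; rewrite gf mulgK.
Qed.

(** A one-parameter subgroup commutes with itself, so Ad fixes its velocity
    along it. *)
Lemma bracketXX X : (br X X) = 0.
Proof.
have [f [[fD fc] fX]] := one_parameter_exists c1 X G_compact.
have f0 := hom_at0 fD.
apply: (bracket_Ad_fixed (fc 0) f0 fX); apply: (@filterE _ (nbhs (0 : R))) => t.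
by apply: (Ad_commute (fc 0) f0 fX) => s; rewrite -!fD addrC.
Qed.

Lemma bracketC X Y : (br X Y) = - (br Y X).
Proof.
apply/eqP; rewrite -addr_eq0; apply/eqP.
by have := bracketXX (X + Y); rewrite bracketDl !bracketDr !bracketXX add0r addr0.
Qed.

(** Conjugation by g carries the curve f to a curve with velocity Ad g X, and
    Ad g (Ad (f t) Y) = Ad (g f t g^-1) (Ad g Y); differentiate at t = 0. *)
Lemma Ad_bracket g X Y : Ad c g (br X Y) = (br (Ad c g X) (Ad c g Y)).
Proof.
have [f [[fD fc] fX]] := one_parameter_exists c1 X G_compact.
have f0 := hom_at0 fD.
have d1 := is_derive_linear (AdD c g) (AdZ c g) (is_derive_Ad c1 Y (fc 0) f0 fX).
have g0 : (g * f 0 * g^-1)%g = 1%g by rewrite f0 mulg1 mulgV.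
have d2 := is_derive_Ad c1 (Ad c g Y) (conj_continuous0 (g := g) (fc 0) f0) g0
  (velocity_Ad c1 g (fc 0) f0 fX).
have E : Ad c g \o (fun t => Ad c (f t) Y) =
    (fun t => Ad c (g * f t * g^-1)%g (Ad c g Y)).
  by apply/funext => t; rewrite -AdM mulgVK AdM.
rewrite E in d1; exact: is_derive_unique d1 d2.
Qed.

(** The derivative at 0 of Ad (f t) [X, Y] = [Ad (f t) X, Ad (f t) Y], where f has
    velocity Z. *)
Lemma jacobi X Y Z : br Z (br X Y) = (br (br Z X) Y) + (br X (br Z Y)).
Proof.
have [f [[fD fc] fZ]] := one_parameter_exists c1 Z G_compact.
have f0 := hom_at0 fD.
apply: is_derive_unique (is_derive_Ad c1 (br X Y) (fc 0) f0 fZ) _.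
rewrite (_ : (fun t => _) = (fun t => (br (Ad c (f t) X) (Ad c (f t) Y)))).
  have := is_derive_bilinear bracketDl bracketZl bracketDr bracketZr
    (is_derive_Ad c1 X (fc 0) f0 fZ) (is_derive_Ad c1 Y (fc 0) f0 fZ).
  by rewrite f0 !Ad1.
by apply/funext => t; rewrite Ad_bracket.
Qed.

(** The derivative at 0 of the constant function
    t |-> <Ad (f t) Y, Ad (f t) Z>, where f has velocity X. *)
Lemma ip_bracket (ip : {dot V for (idfun : R -> R)}) X Y Z :
  Ad_invariant c ip -> ip (br X Y) Z = - ip Y (br X Z).
Proof.
move=> ip_Ad; have [f [[fD fc] fX]] := one_parameter_exists c1 X G_compact.
have f0 := hom_at0 fD.
apply/eqP; rewrite -addr_eq0; apply/eqP.
have d1 := @is_derive_bilinear R R n ip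
  (fun x y z => linearDl ip z x y) (fun k x y => linearZl_LR ip y k x)
  (fun x y z => linearDr ip x y z) (fun k x y => linearZr_LR ip x k y) _ _ _ _
  (is_derive_Ad c1 Y (fc 0) f0 fX) (is_derive_Ad c1 Z (fc 0) f0 fX).
rewrite f0 !Ad1 in d1; apply: is_derive_unique d1 _.
rewrite (_ : (fun t => _) = cst (ip Y Z)).
  exact: (is_derive_cst _ (0 : R) (1 : R)).
by apply/funext => t; rewrite ip_Ad.
Qed.

End lie_algebra.

(** * Vectors fixed by a maximal torus *)

Section fixed_by_torus.
Context {R : realType} {n : nat} {G : lieGroupType R n}.
Hypothesis G_compact : compact [set: G].
Variables (c : chart R n G) (c1 : chart_at1 c).
Local Notation br := (lie_bracket c).
Implicit Types (g h : G) (f : R -> G) (A K S T : set G) (X Y E : 'rV[R]_n).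

Lemma is_derive_shift0 {W : normedModType R} (f : R -> W) (t : R) (X : W) :
  is_derive (0 : R) 1 (fun s => f (s + t)) X -> is_derive t 1 f X.
Proof.
have E : (fun h : R => h^-1 *: ((f \o shift t) (h *: 1) - f t)) =
    (fun h : R => h^-1 *: (((fun s => f (s + t)) \o shift 0) (h *: 1) - f (0 + t))).
  by apply/funext => h /=; rewrite add0r addr0.
move=> [+ <-]; rewrite /derivable /derive -E => H.
exact: DeriveDef.
Qed.

(** Ad (f (t + s)) = Ad (f s) Ad (f t), so the derivative of t |-> Ad (f t) Y
    at s is the image of [X, Y] under Ad (f s). *)
Lemma Ad_one_parameter_fixed f X Y : one_param f -> velocity c f X ->
  br X Y = 0 -> forall t, Ad c (f t) Y = Y.
Proof.
move=> [fD fc] fX XY0 t; have f0 := hom_at0 fD.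
have dAd (s : R) : is_derive s 1 (fun t => Ad c (f t) Y) (0 : 'rV[R]_n).
  apply: is_derive_shift0.
  have := is_derive_linear (AdD c (f s)) (AdZ c (f s))
    (is_derive_Ad c1 Y (fc 0) f0 fX).
  rewrite XY0; have -> : Ad c (f s) 0 = 0 by exact: linear0.
  have -> : Ad c (f s) \o (fun t => Ad c (f t) Y) = (fun t => Ad c (f (t + s)) Y).
    by apply/funext => u; rewrite addrC fD AdM.
  exact.
rewrite -[RHS](Ad1 G_compact c1) -f0; apply/eqP; rewrite -subr_eq0 -normr_le0.
have dfAd (s : R) : differentiable (fun t => Ad c (f t) Y) s.
  by apply/derivable1_diffP; case: (dAd s).
apply: (@mean_value_le _ _ _ (fun t => Ad c (f t) Y) t 0 0) => // s _.
rewrite deriveE// -[t - 0]mulr1 -[(t - 0) * 1]/((t - 0) *: (1 : R)) linearZ/=.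
by rewrite -deriveE// (derive_val (is_derive := dAd _)) scaler0 normr0.
Qed.

Lemma Ad_continuous1 Y : Ad c x Y @[x --> (1 : G)%g] --> Y.
Proof.
have dA := Ad_cinv_differentiable c1 Y.
have := @differentiable_continuous _ _ _ _ _ dA.
rewrite /prop_for /continuous_at (cinv_at1 c1) (Ad1 G_compact c1) => AdY.
have := cvg_comp _ _ (atlas_cfun_continuous c1.1 c1.2) AdY.
apply: cvg_trans; apply: near_eq_cvg.
apply: filterS (nbhs_cdom c1.1 c1.2) => x cx /=.
by rewrite (atlas_cinvK c1.1 cx).
Qed.

Lemma closure_map2 (A B S : set G) (F : G -> G -> G) x y :
  {for (x, y), continuous (fun p : G * G => F p.1 p.2)} ->
  (forall a b, A a -> B b -> S (F a b)) ->
  closure A x -> closure B y -> closure S (F x y).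
Proof.
move=> Fc FABS Ax By W /Fc[[P Q] /= [Px Qy] PQW].
have [a [Aa Pa]] := Ax P Px; have [b [Bb Qb]] := By Q Qy.
exists (F a b); split; first exact: FABS.
exact: (PQW (a, b)).
Qed.

Lemma divg_continuous : continuous (fun p : G * G => (p.1 * p.2^-1)%g).
Proof.
move=> p; apply: mulg_cvg; first exact: cvg_fst.
by apply: invg_cvg; exact: cvg_snd.
Qed.

Lemma closure_subgroup S : subgroup_set S -> subgroup_set (closure S).
Proof.
move=> [S1 SV]; split; first exact: subset_closure.
move=> x y; apply: (@closure_map2 S S S (fun x y => x * y^-1)%g) => //.
exact: divg_continuous.
Qed.

Lemma closure_commute S : (forall x y, S x -> S y -> (x * y)%g = (y * x)%g) ->
  forall x y, closure S x -> closure S y -> (x * y)%g = (y * x)%g.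
Proof.
move=> SC x y Sx Sy; apply: divg1_eq.
have c1' : closed [set (1 : G)%g].
  exact/accessible_closed_set1/hausdorff_accessible/lie_hausdorff.
rewrite -[_ = _]/([set 1%g] _) [X in X _](closure_id _).1//.
apply: (@closure_map2 S S [set 1%g] (fun x y => (x * y) * (y * x)^-1)%g) Sx Sy.
  have xc : p.1 @[p --> (x, y)] --> x by exact: cvg_fst.
  have yc : p.2 @[p --> (x, y)] --> y by exact: cvg_snd.
  by apply: mulg_cvg; [exact: mulg_cvg|apply: invg_cvg; exact: mulg_cvg].
by move=> a b Sa Sb /=; rewrite (SC b a)// mulgV.
Qed.

(** The elements of T commute with the one-parameter subgroup f of velocity E,
    by uniqueness of f. The closure of T f(R) is then a torus containing T, so
    it equals T by maximality, and f is a curve in T. *)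
Lemma tangent_of_Ad_fixed T E : is_maximal_torus T ->
  (forall g, T g -> Ad c g E = E) -> tangent1 c T E.
Proof.
move=> [[sT Tcpt Tconn Tcomm] Tmax] TE.
have [f [[fD fc] fE]] := one_parameter_exists c1 E G_compact.
have f0 := hom_at0 fD.
have gf g t : T g -> (g * f t)%g = (f t * g)%g.
  move=> Tg; pose p t := (g * f t * g^-1)%g.
  have pD : one_param p.
    split=> [s u|s]; first by rewrite /p fD !mulgA mulgVK.
    apply: mulg_cvg; last exact: cvg_cst.
    by apply: mulg_cvg; [exact: cvg_cst|exact: fc].
  have pE : velocity c p E.
    by rewrite -[E](TE _ Tg); exact: (velocity_Ad c1 g (fc 0) f0 fE).
  have pf : p = f := one_parameter_unique c1 pD (conj fD fc) pE fE.
  by rewrite -{2}pf /p mulgVK.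
pose S := [set x | exists g t, T g /\ x = (g * f t)%g].
have sS : subgroup_set S.
  split; first by exists 1%g, 0; split; [exact: sT.1|rewrite f0 mulg1].
  move=> _ _ [g [s [Tg ->]]] [h [t [Th ->]]].
  exists (g * h^-1)%g, (s - t); split; first exact: sT.2.
  have TVh : T h^-1%g by rewrite -[h^-1%g]mul1g; apply: sT.2 => //; exact: sT.1.
  rewrite invgM -(hom_opp t fD) -mulgA [(f s * _)%g]mulgA -fD -(gf _ _ TVh).
  by rewrite mulgA.
have ST g : T g -> S g by exists g, 0; split=> //; rewrite f0 mulg1.
have Sf t : S (f t) by exists 1%g, t; split; [exact: sT.1|rewrite mul1g].
have Sconn : connected S.
  have -> : S = \bigcup_(g in T) (T `|` (fun t => (g * f t)%g) @` setT).
    apply/seteqP; split=> [x [g [t [Tg ->]]]|x [g Tg [Tx|[t _ <-]]]].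
    - by exists g => //; right; exists t.
    - exact: ST.
    - by exists g, t.
  apply: bigcup_connected; first by exists 1%g => g Tg; left; exact: sT.1.
  move=> g Tg; apply: connectedU => //.
    by exists g; split=> //; exists 0; rewrite // f0 mulg1.
  apply: connected_continuous_connected.
    by apply/connected_intervalP => x y _ _ z _.
  apply: continuous_subspaceT => t; apply: mulg_cvg; [exact: cvg_cst|exact: fc].
have Scomm x y : S x -> S y -> (x * y)%g = (y * x)%g.
  move=> [g [s [Tg ->]]] [h [t [Th ->]]].
  rewrite mulgA -[(g * f s * h)%g]mulgA -(gf h)// mulgA (Tcomm g h)//.
  by rewrite -!mulgA -!fD addrC fD !mulgA -[(h * g * f t)%g]mulgA (gf g)// mulgA.
have clT : closure S = T.
  apply: Tmax => [|x Tx]; last by apply: subset_closure; exact: ST.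
  split.
  - exact: closure_subgroup.
  - exact: (subclosed_compact (@closed_closure _ _) G_compact).
  - exact: connected_closure.
  - exact: closure_commute.
exists f; split=> // t; rewrite -clT; exact/subset_closure.
Qed.

End fixed_by_torus.

(** * Subgroups containing the one-parameter subgroups of a closed subgroup *)

Lemma near_mulVg {R : realType} {n : nat} {G : lieGroupType R n} (x : G)
    (P : set G) :
  nbhs (1 : G)%g P -> \forall y \near x, P (x^-1 * y)%g.
Proof.
have FF : Filter (nbhs x) by exact: nbhs_filter.
have xx : y @[y --> x] --> x by exact: cvg_id.
have := mulg_cvg (cvg_cst x^-1%g) xx; rewrite mulVg; exact.
Qed.

Lemma near_divg {R : realType} {n : nat} {G : lieGroupType R n} (x : G)
    (P : set G) :
  nbhs (1 : G)%g P -> \forall y \near x, P (x * y^-1)%g.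
Proof.
have FF : Filter (nbhs x) by exact: nbhs_filter.
have xx : y @[y --> x] --> x by exact: cvg_id.
have := mulg_cvg (cvg_cst x) (invg_cvg xx); rewrite mulgV; exact.
Qed.

Section generated_by_one_parameter_subgroups.
Context {R : realType} {n : nat} {G : lieGroupType R n}.
Hypothesis G_compact : compact [set: G].
Variables (c : chart R n G) (c1 : chart_at1 c).
Variables (T K : set G).
Hypotheses (T_closed : closed T) (T_subgroup : subgroup_set T).
Hypotheses (K_closed : closed K) (K_subgroup : subgroup_set K).
Hypothesis KT : K `<=` T.
Hypothesis K_hom : forall (f : R -> G) X, one_param f -> velocity c f X ->
  (forall t, T (f t)) -> forall t, K (f t).

Let coset_gap h : ~ K h -> exists q, 0 < q /\
  forall z, K z -> ~ cball c q (h * z)%g.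
Proof.
move=> nKh.
have nK : nbhs (1^-1 * h)%g (~` K).
  by rewrite invg1 mul1g; apply: open_nbhs_nbhs; split=> //; exact: closed_openC.
have xh : (x^-1 * h)%g @[x --> (1%g : G)] --> (1^-1 * h)%g.
  by apply: mulg_cvg; [apply: invg_cvg; exact: cvg_id|exact: cvg_cst].
have [q q0 qP] := cball_nbhs1 c1 (xh _ nK).
exists q; split=> // z Kz /qP /=; apply.
rewrite invgM mulgVK; exact: (subgroup_setV K_subgroup).
Qed.

(** By coset_gap the coset h K stays away from 1, so the infimum of the norms of
    the coordinates of its elements is positive, and some element comes within a
    factor 2 of it. *)
Let near_minimizer h r : T h -> ~ K h -> cball c r h ->
  exists y, [/\ T y, ~ K y, cball c r y &
    forall z, K z -> cdom c (y * z)%g ->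
      `|ccoord c y| <= 2 * `|ccoord c (y * z)%g|].
Proof.
move=> Th nKh [ch hr]; have [q [q0 qP]] := coset_gap nKh.
pose D := [set s | exists z,
  [/\ K z, cdom c (h * z)%g & s = `|ccoord c (h * z)%g|]].
have Dlb : lbound D q.
  move=> _ [z [Kz cz ->]]; rewrite leNgt; apply/negP => hzq.
  exact: (qP z Kz (conj cz hzq)).
have D0 : D !=set0.
  exists `|ccoord c h|, 1%g; rewrite mulg1.
  by split; [exact: K_subgroup.1|exact: ch|by []].
have infq : q <= inf D by exact: lb_le_inf.
have hinf : has_inf D by split=> //; exists q.
have D_inf s : D s -> inf D <= s by apply: ge_inf; exists q.
have [hsmall|hbig] := ltP `|ccoord c h| (2 * inf D).
  exists h; split; [exact: Th|exact: nKh|exact: conj|].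
  move=> z Kz cz; apply: (le_trans (ltW hsmall)).
  by rewrite ler_pM2l//; apply: D_inf; exists z.
have [|s [z [Kz cz ->]]] := @inf_adherent _ D (inf D) _ hinf.
  exact: lt_le_trans infq.
rewrite -{1 2}[inf D]mul1r -mulrDl => zs; exists (h * z)%g; split.
- exact: (subgroup_setM T_subgroup Th (KT Kz)).
- move=> Khz; apply: nKh; rewrite -[h](mulgK z); exact: (K_subgroup.2 _ _ Khz Kz).
- split; first exact: cz.
  by apply: lt_le_trans zs _; exact: (le_trans hbig (ltW hr)).
move=> w Kw; rewrite -mulgA => cw; apply: (le_trans (ltW zs)).
rewrite ler_pM2l//; apply: D_inf; exists (z * w)%g; split; [|exact: cw|by []].
exact: (subgroup_setM K_subgroup Kz Kw).
Qed.

(** Otherwise there are y k in T outside K, tending to 1 and nearly as close to 1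
    as their cosets y k K allow. A limit direction X of their coordinates is the
    velocity of a one-parameter subgroup f of T, hence of K. With e k the size of
    y k, the product of y k and f (- e k) lies in the same coset, but its size is
    o(e k): this contradicts the choice of y k. *)
Let K_near1 : \forall x \near (1%g : G), T x -> K x.
Proof.
apply: contrapT => nK.
have yP k : exists y, [/\ T y, ~ K y, cball c k.+1%:R^-1 y &
    forall z, K z -> cdom c (y * z)%g ->
      `|ccoord c y| <= 2 * `|ccoord c (y * z)%g|].
  have : ~ (cball c k.+1%:R^-1 `<=` [set x | T x -> K x]).
    move=> sub; apply: nK; apply: filterS sub _; exact: nbhs1_cball.
  move=> /existsNP [h /not_implyP [hk /not_implyP [Th nKh]]].
  exact: (near_minimizer Th nKh hk).
have [y yE] := choice yP.
have [F [F_ultra ooF]] := @ultraFilterLemma nat \oo _.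
have FF : ProperFilter F := @ultra_proper _ _ F_ultra.
pose e k := `|ccoord c (y k)|.
have cdy k : cdom c (y k) by have [_ _ []] := yE k.
have e0 k : 0 < e k.
  rewrite normr_gt0; apply/eqP => y0; have [_ nKy _ _] := yE k; apply: nKy.
  rewrite (_ : y k = 1%g); first exact: K_subgroup.1.
  by apply: (ccoord_inj c1.1 (cdy k) c1.2); rewrite y0 ccoord1.
have e_cvg : e @ F --> 0.
  have e_oo : e @ \oo --> (0 : R).
    apply: (@squeeze_cvgr _ _ _ _ (fun=> 0) (@harmonic R)).
    - apply: nearW => k; rewrite ltW//=; have [_ _ [_ yk] _] := yE k.
      exact: ltW.
    - exact: cvg_cst.
    - exact: cvg_harmonic.
  by move=> W /e_oo; exact: ooF.
pose v k := (e k)^-1 *: ccoord c (y k).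
have nv k : `|v k| = 1.
  have ek0 := e0 k.
  by rewrite /v normrZ gtr0_norm ?invr_gt0// -/(e k) mulVf// gt_eqF.
have [X v_cvg] : exists X : 'rV[R]_n, v @ F --> X.
  pose B := [set u : 'rV[R]_n | `|u| <= 1].
  have Bcpt : compact B.
    apply: bounded_closed_compact.
      exists 1; split; first exact: num_real.
      by move=> M M1 u uB; apply: le_trans (ltW M1).
    rewrite (_ : B = (fun u => `|u|) @^-1` [set x | x <= 1])//.
    apply: closed_comp; last exact: closed_le.
    by move=> u _; exact: norm_continuous.
  move: Bcpt; rewrite compact_ultra.
  move=> /(_ _ (@ultra_fmap _ _ _ v F_ultra)) [|X [_ vX]].
    by apply: (@filterE _ F) => k; rewrite /B /= nv.
  by exists X.
have Ty k : T (y k) by have [] := yE k.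
have [f [fP Tf fX]] := one_parameter_limit G_compact c1 T_closed T_subgroup
  F_ultra Ty cdy e0 e_cvg v_cvg.
have [fD fc] := fP; have f0 := hom_at0 fD.
have [C [r [C0 r0 KK]]] := mul_second_difference c1.
pose z k := f (- e k).
have Kz k : K (z k) := K_hom fP fX Tf (- e k).
have ne_cvg : - e k @[k --> F] --> (0 : R)^'.
  move=> W [del /= del0 delW].
  have : \forall k \near F, `|e k| < del by move: e_cvg => /cvgr0_norm_lt; apply.
  apply: filterS => k ek; apply: delW; first by rewrite /= sub0r opprK.
  by rewrite oppr_eq0 gt_eqF.
have z_cvg : (e k)^-1 *: ccoord c (z k) @[k --> F] --> - X.
  have := cvg_comp _ _ ne_cvg (velocity_ccoord f0 fX) => /cvgN.
  rewrite (_ : - _ = (fun k => (e k)^-1 *: ccoord c (z k)))//.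
  by apply/funext => k; rewrite fctE /= invrN scaleNr opprK.
have near_y : \forall k \near F, cball c r (y k).
  by move: e_cvg => /cvgr_lt /(_ r r0); apply: filterS => k; split.
have near_z : \forall k \near F, cball c r (z k).
  have nf : nbhs (f 0) (cball c r) by rewrite f0; exact: nbhs1_cball.
  exact: (ne_cvg _ (nbhs_dnbhs (fc 0 _ nf))).
pose u k := (e k)^-1 *: ccoord c (z k).
have small : \forall k \near F, `|v k + u k| + C * (e k * `|u k|) < 2^-1.
  have : `|v k + u k| + C * (e k * `|u k|) @[k --> F] --> `|X - X| + C * (0 * `|X|).
    rewrite -[X in C * (0 * X)]normrN; apply: cvgD.
      by apply: cvg_norm; exact: cvgD.
    apply: cvgM; first exact: cvg_cst.
    by apply: cvgM => //; exact: cvg_norm.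
  rewrite subrr normr0 mul0r mulr0 addr0 => /cvgr_lt; apply.
  by rewrite invr_gt0.
have [k [[by_ bz] sk]] :=
  @filter_ex _ F _ _ (filterI (filterI near_y near_z) small).
have [cyz _] := KK _ _ _ _ by_ by_ bz bz.
have [_ _ _ /(_ _ (Kz k) cyz)] := yE k.
have m := mul_diff c1.2 r0 KK by_ bz.
have ek0 := e0 k.
have yv : ccoord c (y k) = e k *: v k by rewrite /v scalerA mulfV ?gt_eqF// scale1r.
have zu : ccoord c (z k) = e k *: u k by rewrite /u scalerA mulfV ?gt_eqF// scale1r.
move: yv zu sk (nv k); generalize (v k) (u k) => vk uk yv zu sk nvk.
rewrite yv zu -scalerDr !normrZ (gtr0_norm ek0) nvk mulr1 in m *.
set P := ccoord c (y k * z k)%g in m *.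
have := ler_normD (P - e k *: (vk + uk)) (e k *: (vk + uk)).
rewrite subrK normrZ (gtr0_norm ek0).
move: sk; nra.
Qed.

(** K is open in T because it contains a neighbourhood of 1 in T, and it is
    closed. *)
Lemma connected_sub_of_one_parameter : connected T -> T `<=` K.
Proof.
move=> T_conn; suff -> : T = K by [].
apply/esym; apply: T_conn; first by exists 1%g; exact: K_subgroup.1.
- exists [set x | T x -> K x]°; first exact: open_interior.
  apply/seteqP; split=> [x Kx|x [Tx /interior_subset]]; last exact.
  split; first exact: KT.
  have H : \forall y \near x, T (x^-1 * y)%g -> K (x^-1 * y)%g.
    exact: (near_mulVg x K_near1).
  apply: filterS H => y TK Ty.
  rewrite -[y](mulVKg x); apply: subgroup_setM => //; apply: TK.
  apply: (subgroup_setM T_subgroup) => //.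
  by apply: (subgroup_setV T_subgroup); exact: KT.
by exists K => //; rewrite setIidr.
Qed.

End generated_by_one_parameter_subgroups.

(** Passes from the infinitesimal condition to the group: the stabilizer of E in T
    contains every one-parameter subgroup of T. *)
Lemma Ad_fixed_of_bracket {R : realType} {n : nat} {G : lieGroupType R n}
    (c : chart R n G) (T : set G) (E : 'rV[R]_n) :
  compact [set: G] -> chart_at1 c -> closed T -> subgroup_set T ->
  (forall X, tangent1 c T X -> lie_bracket c X E = 0) ->
  connected T -> forall g, T g -> Ad c g E = E.
Proof.
move=> G_compact c1 T_closed T_subgroup TE T_conn.
pose K : set G := [set g | T g /\ Ad c g E = E].
have K_subgroup : subgroup_set K.
  split; first by split; [exact: T_subgroup.1|exact: Ad1].
  move=> x y [Tx xE] [Ty yE]; split; first exact: T_subgroup.2.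
  have yVE := AdM G_compact c1 y^-1%g y E.
  rewrite mulVg (Ad1 G_compact c1) yE in yVE.
  by rewrite (AdM G_compact c1) -yVE.
have K_closed : closed K.
  move=> x clx; have Tx : T x by apply: T_closed; apply: closure_subset clx => y [].
  split; first exact: Tx.
  apply/eqP; rewrite -subr_eq0 -normr_le0; apply/ler_addgt0Pl => e e0.
  rewrite addr0.
  pose P : set G := [set u | `|Ad c u E - E| <= e].
  have nP : nbhs (1%g : G) P.
    by move: (@Ad_continuous1 _ _ _ G_compact c c1 E) => /cvgr_distC_le; apply.
  have nxP := near_divg x nP.
  have [y [[Ty yE] xyE]] := clx _ nxP.
  have AE := AdM G_compact c1 (x * y^-1)%g y E.
  rewrite mulgVK yE in AE.
  by rewrite AE; exact: xyE.
move=> g Tg; have KT : K `<=` T by move=> x [].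
suff [] : K g by [].
apply: (connected_sub_of_one_parameter G_compact c1 T_closed T_subgroup
  K_closed K_subgroup KT _ T_conn Tg).
move=> f X fP fX Tf t; split; first exact: Tf.
apply: (Ad_one_parameter_fixed G_compact c1 fP fX); apply: TE.
exists f; split; [exact: fP.2|exact: hom_at0 fP.1|exact: Tf|exact: fX].
Qed.

(** * Roots of an invariant bracket *)

Section root_systems.
Context {R : realType} {n : nat}.
Local Notation V := 'rV[R]_n.
Variables (br : V -> V -> V) (ip : V -> V -> R).
Hypotheses (brDl : forall X Y Z, br (X + Y) Z = br X Z + br Y Z)
  (brZl : forall k X Y, br (k *: X) Y = k *: br X Y)
  (brDr : forall X Y Z, br X (Y + Z) = br X Y + br X Z)
  (brZr : forall k X Y, br X (k *: Y) = k *: br X Y)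
  (brC : forall X Y, br X Y = - br Y X)
  (brJ : forall X Y Z, br Z (br X Y) = br (br Z X) Y + br X (br Z Y)).
Hypotheses (ipDl : forall X Y Z, ip (X + Y) Z = ip X Z + ip Y Z)
  (ipZl : forall k X Y, ip (k *: X) Y = k * ip X Y)
  (ipC : forall X Y, ip X Y = ip Y X)
  (ip_gt0 : forall X, X != 0 -> 0 < ip X X)
  (ip_br : forall X Y Z, ip (br X Y) Z = - ip Y (br X Z)).
Implicit Types (X Y Z P Q b : V).

Let ipDr X Y Z : ip X (Y + Z) = ip X Y + ip X Z.
Proof. by rewrite ipC ipDl !(ipC X). Qed.
Let ipZr k X Y : ip X (k *: Y) = k * ip X Y.
Proof. by rewrite ipC ipZl (ipC X). Qed.
Let ipNl X Y : ip (- X) Y = - ip X Y.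
Proof. by rewrite -scaleN1r ipZl mulN1r. Qed.
Let ipNr X Y : ip X (- Y) = - ip X Y.
Proof. by rewrite -scaleN1r ipZr mulN1r. Qed.
Let ip0l X : ip 0 X = 0. Proof. by rewrite -(scale0r 0) ipZl mul0r. Qed.
Let ip0r X : ip X 0 = 0. Proof. by rewrite ipC ip0l. Qed.
Let brNl X Y : br (- X) Y = - br X Y.
Proof. by rewrite -scaleN1r brZl scaleN1r. Qed.
Let brNr X Y : br X (- Y) = - br X Y.
Proof. by rewrite -scaleN1r brZr scaleN1r. Qed.
Let ip_eq0 X : ip X X = 0 -> X = 0.
Proof. by move=> XX; apply/eqP/negPn/negP => /ip_gt0; rewrite XX ltxx. Qed.
Let ip_ge0 X : 0 <= ip X X.
Proof.
by have [->|/ip_gt0/ltW//] := eqVneq X 0; rewrite ip0l.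
Qed.
Let brXX X : br X X = 0.
Proof.
have /eqP := brC X X; rewrite -addr_eq0 -mulr2n -scaler_nat scaler_eq0.
by rewrite pnatr_eq0 => /eqP.
Qed.

Variables (tau : {vspace V}) (m : nat) (l : 'I_m -> {vspace V}).
Variables (E F : 'I_m -> V).
Hypotheses (l_sum : (tau + \sum_i l i)%VS = fullv)
  (tau_l : forall i X Y, X \in tau -> Y \in l i -> ip X Y = 0)
  (l_l : forall i j, i != j -> forall X Y, X \in l i -> Y \in l j -> ip X Y = 0)
  (EF_basis : forall i, basis_of (l i) [:: E i; F i])
  (EE : forall i, ip (E i) (E i) = 1) (FF : forall i, ip (F i) (F i) = 1)
  (EF0 : forall i, ip (E i) (F i) = 0).
Hypotheses (br_tau : forall X Y, X \in tau -> Y \in tau -> br X Y = 0)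
  (br_tau_l : forall X i Y, X \in tau -> Y \in l i -> br X Y \in l i)
  (br_tau_E : forall i, exists2 X, X \in tau & br X (E i) != 0).

Let alpha i := br (E i) (F i).

Let El i : E i \in l i. Proof. by rewrite (basis_mem (EF_basis i))// !inE eqxx. Qed.
Let Fl i : F i \in l i.
Proof. by rewrite (basis_mem (EF_basis i))// !inE eqxx orbT. Qed.

Let l_coord i X : X \in l i -> X = ip X (E i) *: E i + ip X (F i) *: F i.
Proof.
rewrite -(span_basis (EF_basis i)) span_cons span_seq1.
move=> /memv_addP[_ /vlineP[a ->] [_ /vlineP[b ->] ->]].
by rewrite !ipDl !ipZl EE FF EF0 (ipC (F i)) EF0 !mulr0 !mulr1 addr0 add0r.
Qed.

Let decomp Z : exists z0 (z : 'I_m -> V), [/\ z0 \in tau, forall i, z i \in l i &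
  Z = z0 + \sum_i z i].
Proof.
have : Z \in (tau + \sum_i l i)%VS by rewrite l_sum memvf.
move=> /memv_addP[z0 z0t [_ /memv_sumP[z zl ->] ->]].
by exists z0, z; split=> // i; exact: zl.
Qed.

Let ip_sumr (I : finType) (p : pred I) (z : I -> V) X :
  ip X (\sum_(i | p i) z i) = \sum_(i | p i) ip X (z i).
Proof. by rewrite (big_morph (ip X) (ipDr X) (ip0r X)). Qed.

Let ip_l i X Y : Y \in l i -> ip X (E i) = 0 -> ip X (F i) = 0 -> ip X Y = 0.
Proof. by move=> /l_coord -> XE XF; rewrite ipDr !ipZr XE XF !mulr0 addr0. Qed.

Lemma ortho_eq0 Z : (forall Y, Y \in tau -> ip Z Y = 0) ->
  (forall i, ip Z (E i) = 0 /\ ip Z (F i) = 0) -> Z = 0.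
Proof.
move=> Zt Zl; apply: ip_eq0; have [z0 [z [z0t zl ZE]]] := decomp Z.
rewrite {2}ZE ipDr Zt// ip_sumr big1 ?addr0// => i _.
by have [ZE' ZF] := Zl i; exact: ip_l (zl i) ZE' ZF.
Qed.

Lemma ortho_tau Z : (forall i, ip Z (E i) = 0 /\ ip Z (F i) = 0) -> Z \in tau.
Proof.
move=> Zl; have [z0 [z [z0t zl ZE]]] := decomp Z.
suff -> : Z = z0 by [].
apply/subr0_eq/ortho_eq0 => [Y Yt|i].
  rewrite ZE addrC addKr ipC ip_sumr big1// => i _; exact: tau_l (zl i).
by rewrite !ipDl !ipNl (Zl i).1 (Zl i).2 !(tau_l (i := i)) ?subrr.
Qed.

Lemma ortho_l k Z : (forall Y, Y \in tau -> ip Z Y = 0) ->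
  (forall j, j != k -> ip Z (E j) = 0 /\ ip Z (F j) = 0) -> Z \in l k.
Proof.
move=> Zt Zl; have [z0 [z [z0t zl ZE]]] := decomp Z.
suff -> : Z = z k by [].
apply/subr0_eq/ortho_eq0 => [Y Yt|i].
  by rewrite ipDl ipNl Zt// ipC (tau_l (i := k))// subrr.
have [->|ik] := eqVneq i k.
  have H Y : Y \in l k -> ip (Z - z k) Y = 0.
    move=> Yk; rewrite ipC ZE (bigD1 k)//= addrA addrAC addrK.
    rewrite ipDr ip_sumr (ipC Y) (tau_l (i := k))// big1 ?addr0// => j jk.
    by apply: (l_l (i := k)) => //; rewrite eq_sym.
  by split; exact: H.
have [ZiE ZiF] := Zl i ik.
by rewrite !ipDl !ipNl ZiE ZiF !(l_l (i := k) (j := i)) ?subrr// eq_sym.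
Qed.

Let skew X Y : ip (br X Y) Y = 0.
Proof.
have /eqP := ip_br X Y Y; rewrite (ipC Y) -addr_eq0 -mulr2n -mulr_natl mulf_eq0.
by rewrite pnatr_eq0 => /eqP.
Qed.

(** br X preserves the plane l i and is skew, so it acts on it as an infinitesimal
    rotation; its speed is <[X, E i], F i> = <X, alpha i>. *)
Lemma br_tauE X i : X \in tau -> br X (E i) = ip X (alpha i) *: F i.
Proof.
move=> Xt; rewrite (l_coord (br_tau_l Xt (El i))) skew scale0r add0r.
by congr (_ *: _); rewrite brC ipNl ip_br opprK.
Qed.

Lemma br_tauF X i : X \in tau -> br X (F i) = - (ip X (alpha i) *: E i).
Proof.
move=> Xt; rewrite (l_coord (br_tau_l Xt (Fl i))) skew scale0r addr0 -scaleNr.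
by congr (_ *: _); rewrite ip_br br_tauE// ipZr FF mulr1.
Qed.

Lemma root_nonzero_on_tau i : exists2 X, X \in tau & ip X (alpha i) != 0.
Proof.
have [X Xt XE] := br_tau_E i; exists X => //; apply: contraNN XE => /eqP X0.
by rewrite br_tauE// X0 scale0r.
Qed.

(** A vector commuting with tau has no component in l i, since some element of tau
    acts on the plane l i by a nonzero multiple of a quarter turn. *)
Lemma centralizer_tau Z : (forall X, X \in tau -> br X Z = 0) -> Z \in tau.
Proof.
move=> ZX; apply: ortho_tau => i; have [X Xt X0] := root_nonzero_on_tau i.
have e1 : ip Z (br X (E i)) = 0 by rewrite -[LHS]opprK -ip_br ZX// ip0l oppr0.
have e2 : ip Z (br X (F i)) = 0 by rewrite -[LHS]opprK -ip_br ZX// ip0l oppr0.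
rewrite br_tauE// ipZr in e1; rewrite br_tauF// ipNr ipZr in e2.
move/eqP: e1; rewrite mulf_eq0 (negPf X0)/= => /eqP e1.
by move/eqP: e2; rewrite oppr_eq0 mulf_eq0 (negPf X0)/= => /eqP e2.
Qed.

Lemma root_in_tau i : alpha i \in tau.
Proof.
apply: centralizer_tau => X Xt; rewrite brJ (br_tauE i Xt) (br_tauF i Xt).
by rewrite brZl brNr brZr !brXX !scaler0 oppr0 addr0.
Qed.

Lemma root_neq0 i : alpha i != 0.
Proof.
by have [X _] := root_nonzero_on_tau i; apply: contraNN => /eqP ->; rewrite ip0r.
Qed.

(** In complex terms, e = E1 - i F1 and x = E2 - i F2 would be orthogonal root
    vectors for the same root. The bracket of conj e and x then has weight 0, and
    it is orthogonal to tau, so it vanishes; this is P0 and Q0. By invariance,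
    |[conj e, x]|^2 - |[e, x]|^2 is a positive multiple of |a|^2 |x|^2, which is
    impossible. In real terms, P0 and Q0 turn |[E1, E2]|^2 + |[E1, F2]|^2 into
    - <F2, [[E1, F1], E2]> = - |a|^2. *)
Lemma no_equal_roots (E1 F1 E2 F2 : V) (a : V) : a \in tau -> a != 0 ->
  a = br E1 F1 -> ip E1 E2 = 0 -> ip E1 F2 = 0 -> ip F1 E2 = 0 -> ip F1 F2 = 0 ->
  ip F2 F2 = 1 ->
  (forall X, X \in tau -> br X E1 = ip X a *: F1) ->
  (forall X, X \in tau -> br X F1 = - (ip X a *: E1)) ->
  (forall X, X \in tau -> br X E2 = ip X a *: F2) ->
  (forall X, X \in tau -> br X F2 = - (ip X a *: E2)) -> False.
Proof.
move=> at_ a0 aE E1E2 E1F2 F1E2 F1F2 F2F2 XE1 XF1 XE2 XF2.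
have ip_br_tau A B Y : Y \in tau -> ip (br A B) Y = ip B (br Y A).
  by move=> Yt; rewrite ip_br brC ipNr opprK.
have P0 : br E1 E2 + br F1 F2 = 0.
  have Pt : br E1 E2 + br F1 F2 \in tau.
    apply: centralizer_tau => X Xt; rewrite brDr (brJ E1 E2) (brJ F1 F2).
    rewrite (XE1 X Xt) (XF1 X Xt) (XE2 X Xt) (XF2 X Xt).
    rewrite !brNl !brNr !brZl !brZr.
    by apply/rowP => k; rewrite !mxE; ring.
  apply: ip_eq0; rewrite [LHS]ipDl !ip_br_tau// XE1// XF1// ipNr !ipZr.
  by rewrite (ipC E2) F1E2 (ipC F2) E1F2 !mulr0 subrr.
have Q0 : br F1 E2 - br E1 F2 = 0.
  have Qt : br F1 E2 - br E1 F2 \in tau.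
    apply: centralizer_tau => X Xt; rewrite brDr brNr (brJ F1 E2) (brJ E1 F2).
    rewrite (XE1 X Xt) (XF1 X Xt) (XE2 X Xt) (XF2 X Xt).
    rewrite !brNl !brNr !brZl !brZr.
    apply/rowP => k; have /rowP/(_ k) := P0; rewrite !mxE; nra.
  apply: ip_eq0; rewrite [LHS]ipDl ipNl !ip_br_tau// XE1// XF1// ipNr !ipZr.
  by rewrite (ipC E2) E1E2 (ipC F2) F1F2 !mulr0 subr0 oppr0.
have aa := ip_gt0 a0.
have A2 : ip (br E1 E2) (br E1 E2) = ip F2 (br F1 (br E1 E2)).
  have /eqP := P0; rewrite addrC addr_eq0 => /eqP F12.
  by rewrite -{1}[br E1 E2]opprK -F12 ipNl ip_br opprK.
have B2 : ip (br E1 F2) (br E1 F2) = - ip F2 (br E1 (br F1 E2)).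
  by have /subr0_eq -> := Q0; rewrite ip_br.
have J := brJ F1 E2 E1; rewrite -aE (XE2 a at_) in J.
have /subr0_eq F1E2E := Q0.
have := ip_ge0 (br E1 E2); have := ip_ge0 (br E1 F2).
rewrite A2 B2 J ipDr ipZr F2F2; lra.
Qed.

Lemma roots_neq i j : i != j -> alpha i != alpha j.
Proof.
move=> ij; apply/negP => /eqP aij.
apply: (@no_equal_roots (E i) (F i) (E j) (F j) (alpha i)) => //.
- exact: root_in_tau.
- exact: root_neq0.
- exact: l_l ij _ _ _ _.
- exact: l_l ij _ _ _ _.
- exact: l_l ij _ _ _ _.
- exact: l_l ij _ _ _ _.
- by move=> X Xt; exact: br_tauE.
- by move=> X Xt; exact: br_tauF.
- by move=> X Xt; rewrite aij; exact: br_tauE.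
- by move=> X Xt; rewrite aij; exact: br_tauF.
Qed.

Lemma roots_neq_opp i j : i != j -> alpha i != - alpha j.
Proof.
move=> ij; apply/negP => /eqP aij.
apply: (@no_equal_roots (E i) (F i) (E j) (- F j) (alpha i)) => //.
- exact: root_in_tau.
- exact: root_neq0.
- exact: l_l ij _ _ _ _.
- by rewrite ipNr (l_l ij) ?oppr0.
- exact: l_l ij _ _ _ _.
- by rewrite ipNr (l_l ij) ?oppr0.
- by rewrite ipNl ipNr opprK.
- by move=> X Xt; exact: br_tauE.
- by move=> X Xt; exact: br_tauF.
- by move=> X Xt; rewrite aij ipNr scaleNr scalerN opprK; exact: br_tauE.
- by move=> X Xt; rewrite aij ipNr brNr br_tauF// scaleNr.
Qed.

Lemma tau_separated Z W : Z \in tau -> W \in tau ->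
  (forall X, X \in tau -> ip X Z = ip X W) -> Z = W.
Proof.
move=> Zt Wt ZW; apply/subr0_eq/ip_eq0.
by rewrite ipDr ipNr ZW ?memvB// subrr.
Qed.

(** Pairing the two equations with E k and F k shows that the pairs
    (<P, F k>, <Q, E k>) and (<P, E k>, <Q, F k>) satisfy proportionality relations
    between b and alpha k, whose only solution is 0 unless b = +- alpha k. *)
Lemma weight_ortho P Q b k : b \in tau ->
  (forall X, X \in tau -> br X P = ip X b *: Q) ->
  (forall X, X \in tau -> br X Q = - (ip X b *: P)) ->
  b != alpha k -> b != - alpha k -> ip P (E k) = 0 /\ ip P (F k) = 0.
Proof.
move=> bt XP XQ bk bNk.
pose p := ip P (E k); pose q := ip P (F k).
pose p' := ip Q (E k); pose q' := ip Q (F k).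
have at_ := root_in_tau k.
have vec (x y : R) : (forall X, X \in tau -> x * ip X b = y * ip X (alpha k)) ->
    x *: b = y *: alpha k.
  move=> H; apply: tau_separated; [exact: memvZ|exact: memvZ|].
  by move=> X Xt; rewrite !ipZr H.
have e1 : p' *: b = - q *: alpha k.
  apply: vec => X Xt; have := ip_br X P (E k).
  by rewrite XP// br_tauE// ipZl ipZr -/p' -/q => H; rewrite mulrC H; ring.
have e2 : q' *: b = p *: alpha k.
  apply: vec => X Xt; have := ip_br X P (F k).
  by rewrite XP// br_tauF// ipZl ipNr ipZr -/p -/q' => H; rewrite mulrC H; ring.
have e3 : p *: b = q' *: alpha k.
  apply: vec => X Xt; have := ip_br X Q (E k).
  rewrite XQ// br_tauE// ipNl ipZl ipZr -/p -/q' => /oppr_inj H.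
  by rewrite mulrC H; ring.
have e4 : q *: b = - p' *: alpha k.
  apply: vec => X Xt; have := ip_br X Q (F k).
  rewrite XQ// br_tauF// ipNl ipNr !ipZl ipZr opprK -/q -/p' => H.
  by rewrite mulrC -[LHS]opprK H; ring.
have kill (x : R) (c : V) : c != 0 -> x *: c = 0 -> x = 0.
  by move=> c0 /eqP; rewrite scaler_eq0 (negPf c0) orbF => /eqP.
have b1 : b - alpha k != 0 by rewrite subr_eq0.
have b2 : b + alpha k != 0 by rewrite addr_eq0.
have f1 : p - q' = 0.
  apply: (kill _ _ b2); apply/rowP => t.
  by move/rowP/(_ t): e2; move/rowP/(_ t): e3; rewrite !mxE; lra.
have f2 : p + q' = 0.
  apply: (kill _ _ b1); apply/rowP => t.
  by move/rowP/(_ t): e2; move/rowP/(_ t): e3; rewrite !mxE; lra.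
have f3 : q + p' = 0.
  apply: (kill _ _ b2); apply/rowP => t.
  by move/rowP/(_ t): e1; move/rowP/(_ t): e4; rewrite !mxE; lra.
have f4 : q - p' = 0.
  apply: (kill _ _ b1); apply/rowP => t.
  by move/rowP/(_ t): e1; move/rowP/(_ t): e4; rewrite !mxE; lra.
by rewrite -/p -/q; split; lra.
Qed.

(** P + i Q and its conjugate are weight vectors of weights -+ i b. P has no
    component in tau because b is nonzero, and only one plane l k can have
    alpha k = +- b because the roots are distinct up to sign. *)
Lemma weight_root_space P Q b : b \in tau -> b != 0 ->
  (forall X, X \in tau -> br X P = ip X b *: Q) ->
  (forall X, X \in tau -> br X Q = - (ip X b *: P)) ->
  P \in root_space l alpha b.
Proof.
move=> bt b0 XP XQ.
have P_tau Y : Y \in tau -> ip P Y = 0.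
  move=> Yt; have YB := br_tau bt Yt.
  have := ip_br b Q Y; rewrite XQ// YB ip0r oppr0 ipNl ipZl => /eqP.
  by rewrite oppr_eq0 mulf_eq0 gt_eqF ?ip_gt0//= => /eqP.
have wo k := weight_ortho bt XP XQ (k := k).
rewrite /root_space; case: pickP => [k bk|nb].
  apply: ortho_l => // j jk; apply: wo; apply/negP => /eqP bj.
    by move: bk; rewrite bj (negPf (roots_neq jk)) (negPf (roots_neq_opp jk)).
  move: bk; rewrite bj eqr_opp (negPf (roots_neq jk)) orbF eqr_oppLR.
  by rewrite (negPf (roots_neq_opp jk)).
rewrite memv0; apply/eqP/ortho_eq0 => // k; have /negbT := nb k.
by rewrite negb_or => /andP[]; exact: wo.
Qed.

Section two_roots.
Variables (i j : 'I_m).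
Hypothesis ij : i != j.
Let lp := root_space l alpha (alpha i + alpha j).
Let lm := root_space l alpha (alpha i - alpha j).

Let sum_neq0 : alpha i + alpha j != 0.
Proof. by rewrite addr_eq0 roots_neq_opp. Qed.
Let diff_neq0 : alpha i - alpha j != 0.
Proof. by rewrite subr_eq0 roots_neq. Qed.
Let sum_tau : alpha i + alpha j \in tau.
Proof. by rewrite memvD ?root_in_tau. Qed.
Let diff_tau : alpha i - alpha j \in tau.
Proof. by rewrite memvB ?root_in_tau. Qed.

(* Real and, up to sign, imaginary parts of the brackets of E i - i F i with
   E j - i F j and with E j + i F j: these are rotated at the sum and at the
   difference of the speeds at which tau rotates l i and l j. *)
Let P := br (E i) (E j) - br (F i) (F j).
Let Q := br (E i) (F j) + br (F i) (E j).
Let P' := br (E i) (E j) + br (F i) (F j).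
Let Q' := br (F i) (E j) - br (E i) (F j).

Let brackets X : X \in tau ->
  [/\ br X P = ip X (alpha i + alpha j) *: Q,
      br X Q = - (ip X (alpha i + alpha j) *: P),
      br X P' = ip X (alpha i - alpha j) *: Q' &
      br X Q' = - (ip X (alpha i - alpha j) *: P')].
Proof.
move=> Xt; rewrite /P /Q /P' /Q' !brDr !brNr.
rewrite (brJ (E i) (E j)) (brJ (F i) (F j)) (brJ (E i) (F j)) (brJ (F i) (E j)).
rewrite !(br_tauE _ Xt) !(br_tauF _ Xt) !brNl !brNr !brZl !brZr !ipDr !ipNr.
by split; apply/rowP => k; rewrite !mxE; ring.
Qed.

Lemma bracket_in_root_spaces X Y : X \in l i -> Y \in l j ->
  br X Y \in (lp + lm)%VS.
Proof.
have Pp : P \in lp.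
  by apply: (weight_root_space (Q := Q)) sum_tau sum_neq0 _ _ => W /brackets[].
have Qp : Q \in lp.
  apply: (weight_root_space (Q := - P)) sum_tau sum_neq0 _ _ => W /brackets[].
    by rewrite scalerN.
  by rewrite brNr => -> _ _ _.
have Pm : P' \in lm.
  by apply: (weight_root_space (Q := Q')) diff_tau diff_neq0 _ _ => W /brackets[].
have Qm : Q' \in lm.
  apply: (weight_root_space (Q := - P')) diff_tau diff_neq0 _ _ => W /brackets[].
    by rewrite scalerN.
  by rewrite brNr => _ _ -> _.
have half (Z S D : V) : Z = 2^-1 *: S + 2^-1 *: D -> S \in lp -> D \in lm ->
    Z \in (lp + lm)%VS.
  by move=> -> Sp Dm; apply: memv_add; exact: memvZ.
have EEm : br (E i) (E j) \in (lp + lm)%VS.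
  by apply: half Pp Pm; apply/rowP => k; rewrite !mxE; field.
have FFm : br (F i) (F j) \in (lp + lm)%VS.
  apply: (half _ (- P) P'); rewrite ?memvN//.
  by apply/rowP => k; rewrite !mxE; field.
have EFm : br (E i) (F j) \in (lp + lm)%VS.
  apply: (half _ Q (- Q')); rewrite ?memvN//.
  by apply/rowP => k; rewrite !mxE; field.
have FEm : br (F i) (E j) \in (lp + lm)%VS.
  by apply: half Qp Qm; apply/rowP => k; rewrite !mxE; field.
move=> /l_coord -> /l_coord ->.
by rewrite !brDl !brDr !brZl !brZr !memvD ?memvZ.
Qed.

(** Distinct planes are orthogonal; if the two planes coincide, alpha i + alpha j
    and alpha i - alpha j agree up to sign, so that a root vanishes. *)
Lemma root_spaces_direct : directv (lp + lm).
Proof.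
apply/directv_addP/eqP; rewrite -subv0; apply/subvP => v.
rewrite memv_cap memv0 /lp /lm /root_space => /andP[].
case: pickP => [k pk|_]; last by rewrite memv0.
case: pickP => [k' mk'|_]; last by rewrite memv0.
have [kk|kk vk vk'] := eqVneq k k'; last first.
  by apply/eqP/ip_eq0; exact: (l_l kk).
have double b : b + b = 0 -> b = 0.
  by move=> /eqP; rewrite -mulr2n -scaler_nat scaler_eq0 pnatr_eq0 => /eqP.
exfalso; have /eqP ai := root_neq0 i; have /eqP aj := root_neq0 j.
move: pk mk'; rewrite -{k'}kk => /orP[]/eqP pk /orP[]/eqP mk.
- apply: aj; apply: double; rewrite -(subrr (alpha k)) -{1}pk -mk.
  by apply/rowP => t; rewrite !mxE; ring.
- apply: ai; apply: double; rewrite -(subrr (alpha k)) -{1}pk -mk.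
  by apply/rowP => t; rewrite !mxE; ring.
- apply: ai; apply: double; rewrite -(subrr (alpha k)) -{1}mk -pk.
  by apply/rowP => t; rewrite !mxE; ring.
- apply: aj; apply: double; rewrite -(subrr (- alpha k)) -{1}pk -mk.
  by apply/rowP => t; rewrite !mxE; ring.
Qed.

End two_roots.

End root_systems.

(** * The bracket theorem *)

Section torus_action.
Context {R : realType} {n : nat} {G : lieGroupType R n}.
Hypothesis G_compact : compact [set: G].
Variables (c : chart R n G) (c1 : chart_at1 c).
Variable T : set G.
Local Notation br := (lie_bracket c).

Lemma tangent_bracket_commute X Y :
  (forall x y, T x -> T y -> (x * y)%g = (y * x)%g) ->
  tangent1 c T X -> tangent1 c T Y -> br X Y = 0.
Proof.
move=> T_comm [f [fc f0 Tf fX]] [h [hc h0 Th hY]].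
apply: (bracket_Ad_fixed c1 (fc 0) f0 fX).
apply: (@filterE _ (nbhs (0 : R))) => t.
by apply: (Ad_commute c1 (hc 0) h0 hY) => s; exact: T_comm.
Qed.

(** The derivative at 0 of <Ad (f t) Y, W> = 0, where f is a curve in T with
    velocity X. *)
Lemma tangent_bracket_ortho (ip : {dot 'rV[R]_n for (idfun : R -> R)}) X Y W :
  tangent1 c T X -> (forall g, T g -> ip (Ad c g Y) W = 0) -> ip (br X Y) W = 0.
Proof.
move=> [f [fc f0 Tf fX]] YW.
have d1 := @is_derive_linear R n R (ip^~ W) _ _
  (fun x y => linearDl ip W x y) (fun k x => linearZl_LR ip W k x)
  (is_derive_Ad c1 Y (fc 0) f0 fX).
apply: is_derive_unique d1 _.
rewrite (_ : _ \o _ = cst 0); first exact: (is_derive_cst _ (0 : R) (1 : R)).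
by apply/funext => t; exact: YW.
Qed.

End torus_action.

Unset Implicit Arguments.

Theorem theorem10p15 (R : realType) (n : nat) (G : lieGroupType R n)
  (G_compact : compact [set: G])
  (c : chart R n G) (c1 : chart_at1 c)
  (ip : {dot 'rV[R]_n for (idfun : R -> R)}) (ip_Ad : Ad_invariant c ip)
  (T : set G) (T_max : is_maximal_torus T)
  (tau : {vspace 'rV[R]_n})
  (tauE : forall X : 'rV[R]_n, X \in tau <-> tangent1 c T X)
  (m : nat) (l : 'I_m -> {vspace 'rV[R]_n})
  (l_dec : root_decomposition c ip T tau l)
  (E F : 'I_m -> 'rV[R]_n)
  (EF : forall i, orthonormal_basis2 ip (l i) (E i) (F i))
  (i j : 'I_m) (ij : i != j) :
  let alpha := dual_root c E F in
  let lp := root_space l alpha (alpha i + alpha j) in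
  let lm := root_space l alpha (alpha i - alpha j) in
  directv (lp + lm) /\
  (forall X Y : 'rV[R]_n, X \in l i -> Y \in l j ->
     lie_bracket c X Y \in (lp + lm)%VS).
Proof.
have [[T_subgroup T_compact T_connected T_comm] _] := T_max.
have T_closed : closed T by exact: compact_closed lie_hausdorff T_compact.
have [l_sum tau_l l_l _ l_Ad] := l_dec.
have EF_basis k : basis_of (l k) [:: E k; F k] by have [] := EF k.
have EE k : ip (E k) (E k) = 1 by have [] := EF k.
have FF k : ip (F k) (F k) = 1 by have [] := EF k.
have EF0 k : ip (E k) (F k) = 0 by have [] := EF k.
have El k : E k \in l k by rewrite (basis_mem (EF_basis k))// !inE eqxx.
have Fl k : F k \in l k by rewrite (basis_mem (EF_basis k))// !inE eqxx orbT.
have ipDl X Y Z : ip (X + Y) Z = ip X Z + ip Y Z := linearDl ip Z X Y.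
have ipZl k X Y : ip (k *: X) Y = k * ip X Y := linearZl_LR ip Y k X.
have ipC X Y : ip X Y = ip Y X by rewrite (hermC ip X Y) /= mul1r.
have ip_gt0 X : X != 0 -> 0 < ip X X := @neq0_dnorm_gt0 _ _ _ ip X.
have ip_br X Y Z := ip_bracket G_compact c1 X Y Z ip_Ad.
have br_tau X Y : X \in tau -> Y \in tau -> lie_bracket c X Y = 0.
  by move=> /tauE Xt /tauE Yt; exact: (tangent_bracket_commute c1 T_comm).
have br_tau_l X k Y : X \in tau -> Y \in l k -> lie_bracket c X Y \in l k.
  move=> /tauE Xt Yl; apply: (ortho_l ipDl ipZl ipC ip_gt0 l_sum tau_l l_l EF_basis
    EE FF EF0).
    move=> W Wt; apply: (tangent_bracket_ortho c1 Xt) => g Tg.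
    by rewrite ipC; apply: tau_l Wt _; exact: l_Ad Tg _ _ Yl.
  move=> k' kk'; split; apply: (tangent_bracket_ortho c1 Xt) => g Tg.
    by rewrite ipC; apply: l_l kk' _ _ _ (l_Ad _ Tg _ _ Yl).
  by rewrite ipC; apply: l_l kk' _ _ _ (l_Ad _ Tg _ _ Yl).
(* A root vanishing on tau would give a vector E k fixed by all of T, hence
   tangent to T, although E k is orthogonal to tau. *)
have br_tau_E k : exists2 X, X \in tau & lie_bracket c X (E k) != 0.
  apply: contrapT => noX.
  have XE X : tangent1 c T X -> lie_bracket c X (E k) = 0.
    move=> XT; apply/eqP/negPn/negP => XE; apply: noX.
    by exists X => //; exact/tauE.
  have TE := Ad_fixed_of_bracket G_compact c1 T_closed T_subgroup XE T_connected.
  have /tauE Et := tangent_of_Ad_fixed G_compact c1 T_max TE.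
  have := tau_l k _ _ Et (El k); rewrite EE => /eqP; rewrite oner_eq0.
  by [].
split.
  exact: (root_spaces_direct (bracketC G_compact c1) ipDl ipZl ipC ip_gt0 ip_br
    l_l EF_basis EE FF EF0 br_tau_l br_tau_E).
exact: (bracket_in_root_spaces (bracketDl c) (bracketZl c) (bracketDr G_compact c1)
    (bracketZr G_compact c1) (bracketC G_compact c1) (jacobi G_compact c1)
    ipDl ipZl ipC ip_gt0 ip_br l_sum tau_l l_l EF_basis EE FF EF0 br_tau
    br_tau_l br_tau_E ij).
Qed.
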